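(* Let $W$ be a weighted small-step walk in the quadrant with probability matrix $P_\infty$ and associated group $G_W$. The group $G_W$ is of order $6$ if and only if, up to the symmetries, the probability matrix $P_\infty$ belongs to one of the following three families: $$\text{(I)}\quad \begin{pmatrix} 0 & p_{10} & 0 \\ 0 & p_{00} & p_{0,-1} \\ p_{-1,1} & 0 & 0 \end{pmatrix},\qquad p_{10}\,p_{0,-1}\,p_{-1,1}\neq0;$$ $$\text{(II)}\quad \begin{pmatrix} 0 & p_{10} & p_{1,-1} \\ 0 & p_{00} & p_{0,-1} \\ p_{-1,1} & \dfrac{2p_{1,-1}p_{-1,1}}{p_{10}} & \dfrac{p_{1,-1}^{2}\,p_{-1,1}}{p_{10}^{2}} \end{pmatrix},\qquad p_{10}\,p_{1,-1}\,p_{-1,1}\neq0;$$ $$\text{(III)}\quad \begin{pmatrix} 0 & \dfrac{p_{1,-1}p_{-1,1}}{p_{-1,0}} & p_{1,-1} \\ \dfrac{p_{1,-1}p_{-1,1}}{p_{0,-1}} & p_{00} & p_{0,-1} \\ p_{-1,1} & p_{-1,0} & 0 \end{pmatrix},\qquad p_{1,-1}\,p_{-1,1}\,p_{0,-1}\,p_{-1,0}\neq0.$$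
   Context: A weighted small-step walk $W$ in the quadrant is given by real weights $p_{ij}\ge 0$, $i,j\in\{-1,0,1\}$, with $\sum_{i,j=-1}^{1}p_{ij}=1$. Its probability matrix is $$P_\infty=\begin{pmatrix} p_{11} & p_{10} & p_{1,-1} \\ p_{01} & p_{00} & p_{0,-1} \\ p_{-1,1} & p_{-1,0} & p_{-1,-1} \end{pmatrix}.$$ Its inventory is $$\chi_W(x,y)=\sum_{i,j=-1}^1 p_{ij}x^iy^j = xA_1(y)+B_1(y)+\frac{C_1(y)}{x}=yA_2(x)+B_2(x)+\frac{C_2(x)}{y},$$ where $A_1,B_1,C_1$ are Laurent polynomials in $y$ and $A_2,B_2,C_2$ are Laurent polynomials in $x$. It is assumed that none of $A_1,C_1,A_2,C_2$ is identically zero, so that $$\varphi_1(x,y)=\left(\frac{C_1(y)}{xA_1(y)},\,y\right),\qquad \varphi_2(x,y)=\left(x,\,\frac{C_2(x)}{yA_2(x)}\right)$$ are birational involutions of the $(x,y)$-plane. The group of $W$ is $G_W=\langle\varphi_1,\varphi_2\rangle$, the group of birational transformations of the $(x,y)$-plane generated by them. ''Up to the symmetries'' means up to the action of the eight symmetries of the square on the index set $\{-1,0,1\}^2$ of the weights, generated by $(i,j)\mapsto(-i,j)$, $(i,j)\mapsto(i,-j)$ and $(i,j)\mapsto(j,i)$ (i.e. reversing the order of the rows, reversing the order of the columns, and transposing $P_\infty$). *)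

(* Defs.v *)
From HB Require Import structures.
From mathcomp Require Import all_boot all_order all_algebra.
From mathcomp Require Import fraction.
From mathcomp Require Import mpoly.
From mathcomp Require Import classical_sets cardinality reals.

Set Implicit Arguments.
Unset Strict Implicit.
Unset Printing Implicit Defensive.

Import Order.TTheory GRing.Theory Num.Theory.
Local Open Scope ring_scope.
Local Open Scope classical_set_scope.

Section BirationalMaps.
Variable R : realType.

(* The field R(x, y). *)
Definition ratfun : fieldType := {fraction {mpoly R[2]}}.

Definition ratpoly (p : {mpoly R[2]}) : ratfun := tofrac p.

Definition ratC (c : R) : ratfun := ratpoly c%:MP.
Definition ratX : ratfun := ratpoly 'X_0.
Definition ratY : ratfun := ratpoly 'X_1.

(* A rational map (x, y) |-> (u(x, y), v(x, y)) of the plane is the pair of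
   its components. *)
Definition ratmap := (ratfun * ratfun)%type.

Definition polysubst (phi : ratmap) (p : {mpoly R[2]}) : ratfun :=
  mmap ratC (fun i : 'I_2 => if i == 0 then phi.1 else phi.2) p.

(* f(u, v) for phi = (u, v).  When the denominator of the chosen representative
   of f vanishes at (u, v), the division makes this 0; this cannot happen when
   u and v are algebraically independent over R, in particular when phi is
   birational, and then the value does not depend on the representative. *)
Definition ratsubst (phi : ratmap) (f : ratfun) : ratfun :=
  let r : {ratio {mpoly R[2]}} := repr (f : {fraction {mpoly R[2]}}) in
  polysubst phi \n_r / polysubst phi \d_r.

Definition rat_id : ratmap := (ratX, ratY).

(* The composite "psi first, then phi". *)
Definition rat_comp (phi psi : ratmap) : ratmap :=
  (ratsubst psi phi.1, ratsubst psi phi.2).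

Definition rat_inverse (phi psi : ratmap) : Prop :=
  rat_comp phi psi = rat_id /\ rat_comp psi phi = rat_id.

Definition birational : set ratmap :=
  [set phi | exists psi, rat_inverse phi psi].

Definition birational_subgroup (H : set ratmap) : Prop :=
  [/\ H `<=` birational,
      H rat_id,
      forall phi psi, H phi -> H psi -> H (rat_comp phi psi) &
      forall phi psi, H phi -> rat_inverse phi psi -> H psi].

End BirationalMaps.

Arguments ratC {R} c.
Arguments ratX {R}.
Arguments ratY {R}.
Arguments rat_id {R}.

Section Walks.
Variable R : realType.
Implicit Types P Q : 'M[R]_3.

(* The probability matrix lists the weights in decreasing order of the steps:
   its entry in row r and column c is p_ij with i = step r and j = step c. *)
Definition step (k : 'I_3) : int := 1 - k%:Z.

Definition inventory P : ratfun R :=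
  \sum_(r < 3) \sum_(c < 3) ratC (P r c) * ratX ^ step r * ratY ^ step c.

Definition A1 P : ratfun R := \sum_(c < 3) ratC (P 0 c) * ratY ^ step c.
Definition B1 P : ratfun R := \sum_(c < 3) ratC (P 1 c) * ratY ^ step c.
Definition C1 P : ratfun R := \sum_(c < 3) ratC (P 2 c) * ratY ^ step c.

Definition A2 P : ratfun R := \sum_(r < 3) ratC (P r 0) * ratX ^ step r.
Definition B2 P : ratfun R := \sum_(r < 3) ratC (P r 1) * ratX ^ step r.
Definition C2 P : ratfun R := \sum_(r < 3) ratC (P r 2) * ratX ^ step r.

Definition phi1 P : ratmap R := (C1 P / (ratX * A1 P), ratY).
Definition phi2 P : ratmap R := (ratX, C2 P / (ratY * A2 P)).

(* When A1, C1, A2, C2 are nonzero, phi1 and phi2 are involutions, hence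
   birational, and the family being intersected is not empty. *)
Definition walk_group P : set (ratmap R) :=
  smallest (@birational_subgroup R) [set phi1 P; phi2 P].

Inductive square_orbit P : 'M[R]_3 -> Prop :=
| SquareId : square_orbit P P
| SquareRows Q : square_orbit P Q -> square_orbit P (rowsub (@rev_ord 3) Q)
| SquareCols Q : square_orbit P Q -> square_orbit P (colsub (@rev_ord 3) Q)
| SquareTr Q : square_orbit P Q -> square_orbit P Q^T.

Definition mx3 (rows : seq (seq R)) : 'M[R]_3 :=
  \matrix_(r, c) (nth [::] rows r)`_c.

(* Below, a letter m in an index stands for -1. *)

Definition family_I P : Prop :=
  exists p10 p00 p0m pm1 : R,
    P = mx3 [:: [::   0; p10;   0];
                [::   0; p00; p0m];
                [:: pm1;   0;   0]]
    /\ p10 * p0m * pm1 != 0.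

Definition family_II P : Prop :=
  exists p10 p1m p00 p0m pm1 : R,
    P = mx3 [:: [::   0; p10; p1m];
                [::   0; p00; p0m];
                [:: pm1; 2 * p1m * pm1 / p10; p1m ^+ 2 * pm1 / p10 ^+ 2]]
    /\ p10 * p1m * pm1 != 0.

Definition family_III P : Prop :=
  exists p1m p00 p0m pm1 pm0 : R,
    P = mx3 [:: [:: 0; p1m * pm1 / pm0; p1m];
                [:: p1m * pm1 / p0m; p00; p0m];
                [:: pm1; pm0; 0]]
    /\ p1m * pm1 * p0m * pm0 != 0.

End Walks.

Section Facts.

Lemma sum_step (F : fieldType) (x : F) (a : 'I_3 -> F) :
  \sum_(k < 3) a k * x ^ step k = x * a 0 + a 1 + a 2 / x.
Proof.
rewrite !big_ord_recl big_ord0 addr0 addrA.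
rewrite (_ : lift ord0 ord0 = 1); last exact: val_inj.
rewrite (_ : lift ord0 _ = 2); last exact: val_inj.
rewrite (_ : step _ = 1) // (_ : step 1 = 0) // (_ : step 2 = -1) //.
by rewrite expr1z expr0z mulr1 exprN1 [a _ * x]mulrC.
Qed.

Variables (R : realType) (P : 'M[R]_3).

Lemma inventory_x : inventory P = ratX * A1 P + B1 P + C1 P / ratX.
Proof.
rewrite -(sum_step ratX (fun r => \sum_(c < 3) ratC (P r c) * ratY ^ step c)).
apply: eq_bigr => r _; rewrite mulr_suml.
by apply: eq_bigr => c _; rewrite mulrAC.
Qed.

Lemma inventory_y : inventory P = ratY * A2 P + B2 P + C2 P / ratY.
Proof.
rewrite -(sum_step ratY (fun c => \sum_(r < 3) ratC (P r c) * ratX ^ step r)).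
rewrite /inventory exchange_big; apply: eq_bigr => c _; rewrite mulr_suml.
by apply: eq_bigr.
Qed.

End Facts.

(* Main.v *)
Require Import Defs.
From HB Require Import structures.
From mathcomp Require Import all_boot all_order all_algebra.
From mathcomp Require Import fraction generic_quotient.
From mathcomp Require Import mpoly.
From mathcomp Require Import boolp classical_sets cardinality reals.
From mathcomp Require Import zify ring lra.

(** Since the weights are nonnegative, the quotients F = C1/A1 and G = C2/A2
    are positive on the positive half-line.  So phi1 and phi2 restrict to
    genuine involutions (x, y) |-> (F(y)/x, y) and (x, y) |-> (x, G(x)/y) of the
    open positive quadrant, and because the quadrant is Zariski dense two
    rational maps are equal as soon as they agree there
    ([mpoly_eq0_quadrant], [acts_as_eq]).  All questions about the group become
    questions about honest functions.

    The group is generated by two distinct involutions, so it is dihedral of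
    order 2k where k is the order of phi1 phi2 ([card_dihedral]); it has order 6
    exactly when (phi1 phi2)^3 = 1, that is when the hexagon (x0, y0), (x1, y0),
    (x1, y1), (x2, y1), (x2, y2), (x0, y2) closes up for all starting points,
    where consecutive abscissae on a height y multiply to F(y) and consecutive
    ordinates over x multiply to G(x).  This is a pair of functional equations
    for F and G ([hexagonal], [order6_hexagonal]), stable under the symmetries
    of the square ([square_orbit_hexagonal]).

    In families I and III both F and G are linear, and in family II one has
    F(y) = a (y + e) and G(x) = (e/a) (x^2 + r x + a e); in each case the
    functional equations are identities of rational functions
    ([families_hexagonal]).

    Conversely, assume that the hexagon closes.  Put y = 1 and let x tend to
    infinity: no cancellation happens between nonnegative terms, so both sides
    of the equation grow like explicit integer powers of x which depend only
    on the set of nonzero weights ([closes_trop]).  Equality of these exponents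
    is a condition on finitely many zero patterns, and up to symmetry it leaves
    the patterns of the three families ([trop_shapely]).  The pattern of
    family I needs nothing more.  For the other two, the equation at one well
    chosen height y, cleared of denominators, is an identity between polynomials
    of degree 6 in x, whose top three coefficients force the relations between
    the weights ([closes_quadratic], [closes_homographic]). *)

Set Implicit Arguments.
Unset Strict Implicit.
Unset Printing Implicit Defensive.

Import Order.TTheory GRing.Theory Num.Theory.
Local Open Scope ring_scope.

(** * Density of the positive quadrant *)

Lemma poly_eq0_pos (R : realFieldType) (p : {poly R}) :
  (forall x, 0 < x -> p.[x] = 0) -> p = 0.
Proof.
move=> p0; apply/eqP; apply: contraT => pn0.
have := max_poly_roots (rs := [seq i.+1%:R | i <- iota 0 (size p)]) pn0.
rewrite size_map size_iota ltnn => H; suff: false by []; apply: H.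
  by apply/allP => _ /mapP[i _ ->]; rewrite /root p0 // ltr0Sn.
rewrite map_inj_uniq ?iota_uniq // => i j /eqP.
by rewrite eqr_nat => /eqP[].
Qed.

Section Quadrant.
Variable R : realType.

Definition quadrant := {z : R * R | (0 < z.1) && (0 < z.2)}.

Definition unit_point : quadrant.
Proof. by exists (1, 1); rewrite /= ltr01. Defined.

Implicit Types (z : quadrant) (p : {mpoly R[2]}).

Definition xcoord z : R := (val z).1.
Definition ycoord z : R := (val z).2.

Lemma xcoord_gt0 z : 0 < xcoord z.
Proof. by case/andP: (valP z). Qed.

Lemma ycoord_gt0 z : 0 < ycoord z.
Proof. by case/andP: (valP z). Qed.

Lemma quadrant_eq z w : xcoord z = xcoord w -> ycoord z = ycoord w -> z = w.
Proof.
rewrite /xcoord /ycoord => h1 h2; apply: val_inj.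
by rewrite [val z]surjective_pairing h1 h2 -surjective_pairing.
Qed.

Definition qpoint (x y : R) : quadrant := insubd unit_point (x, y).

Lemma xcoord_qpoint x y : 0 < x -> 0 < y -> xcoord (qpoint x y) = x.
Proof. by move=> x0 y0; rewrite /xcoord val_insubd /= x0 y0. Qed.

Lemma ycoord_qpoint x y : 0 < x -> 0 < y -> ycoord (qpoint x y) = y.
Proof. by move=> x0 y0; rewrite /ycoord val_insubd /= x0 y0. Qed.

Definition coords z (i : 'I_2) : R := if i == 0 then xcoord z else ycoord z.

(** For a fixed ordinate y > 0 the polynomial in x has infinitely many roots, so
    each of its coefficients vanishes; these are polynomials in y with
    infinitely many roots again. *)
Lemma mpoly_eq0_quadrant p : (forall z, p.@[coords z] = 0) -> p = 0.
Proof.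
move=> p0; apply/mpolyP => m; rewrite mcoeff0.
pose k := maxn (msize p) (mdeg m).+1.
have mk : (mdeg m < k)%N by rewrite leq_maxr.
have pk : p = \sum_(m : 'X_{1..2 < k}) (p@_m *: 'X_[m]).
  by apply: mpolywE; rewrite leq_maxl.
have eval z : p.@[coords z] =
   \sum_(m : 'X_{1..2 < k})
     p@_m * (xcoord z ^+ m ord0 * ycoord z ^+ m (lift ord0 ord0)).
  rewrite {1}pk raddf_sum; apply: eq_bigr => i _.
  by rewrite /= mevalZ mevalX !big_ord_recl big_ord0 mulr1.
have px y : 0 < y -> \sum_(n : 'X_{1..2 < k})
    (p@_n * y ^+ n (lift ord0 ord0)) *: 'X^(n ord0) = 0 :> {poly R}.
  move=> y0; apply: poly_eq0_pos => x x0.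
  rewrite -[RHS](p0 (qpoint x y)) eval horner_sum; apply: eq_bigr => i _.
  by rewrite !hornerE xcoord_qpoint // ycoord_qpoint //; exact: mulrAC.
have py : \sum_(n : 'X_{1..2 < k} | n ord0 == m ord0)
    p@_n *: 'X^(n (lift ord0 ord0)) = 0 :> {poly R}.
  apply: poly_eq0_pos => y y0.
  have /(congr1 (fun q : {poly R} => q`_(m ord0))) := px y y0.
  rewrite coef0 coef_sum => <-; rewrite horner_sum [LHS]big_mkcond.
  apply: eq_bigr => i _; rewrite coefZ coefXn eq_sym.
  by case: eqP => _; rewrite !hornerE // mulr1.
have /(congr1 (fun q : {poly R} => q`_(m (lift ord0 ord0)))) := py.
rewrite coef0 coef_sum (bigD1 (BMultinom mk)) //=.
rewrite coefZ coefXn eqxx mulr1 big1 ?addr0 // => i /andP[/eqP i0 im].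
rewrite coefZ coefXn; case: eqP => [e|_]; last by rewrite mulr0.
case/eqP: im; apply: val_inj; apply/mnmP => j /=.
have [->//|[j' ->]] : j = ord0 \/ exists j', j = lift ord0 j'.
  by case: (unliftP ord0 j) => [j' ->|->]; [right; exists j'|left].
by rewrite (ord1 j') -e.
Qed.

End Quadrant.

(** * Rational maps acting on the positive quadrant *)

(** Substitution into a rational function is defined through the representative
    that [repr] selects, so its numerator and denominator must be tied to the
    fraction. *)
Lemma frac_repr (D : idomainType) (f : {fraction D}) :
  f = tofrac \n_(repr f) / tofrac \d_(repr f).
Proof.
rewrite -[LHS]reprK; set r := repr f.
unlock FracField.tofrac.
rewrite -[X in _ * X]FracField.pi_inv -[RHS]FracField.pi_mul.
have r0 : \d_r != 0 by [].
apply/eqmodP; rewrite /= FracField.equivfE.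
rewrite /FracField.mulf /FracField.invf.
rewrite !numden_Ratio ?oner_neq0 ?mul1r ?mulr1 //.
by rewrite mulrC.
Qed.

Section Values.
Variable R : realType.
Implicit Types (f g : ratfun R) (u v : quadrant R -> R) (p : {mpoly R[2]}).
Implicit Types (z : quadrant R) (phi psi : ratmap R).

(** The denominator is required to vanish nowhere on the quadrant: the value
    u z is then meaningful at every point, and the rational functions that have
    values form a ring. *)
Definition has_values f u : Prop :=
  exists n d, f = ratpoly n / ratpoly d /\
    forall z, d.@[coords z] != 0 /\ u z = n.@[coords z] / d.@[coords z].

Let ratpolyM p q : ratpoly (p * q) = ratpoly p * ratpoly q.
Proof. exact: tofracM. Qed.

Let ratpolyD p q : ratpoly (p + q) = ratpoly p + ratpoly q.
Proof. exact: tofracD. Qed.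

Let ratpoly_eq0 p : (ratpoly p == 0) = (p == 0).
Proof. exact: tofrac_eq0. Qed.

Let ratpoly_inj : injective (@ratpoly R).
Proof. by move=> p q /eqP; rewrite tofrac_eq => /eqP. Qed.

Let den_neq0 p : (forall z, p.@[coords z] != 0) -> ratpoly p != 0.
Proof.
move=> pn0; rewrite ratpoly_eq0; apply: contraTneq (pn0 (unit_point R)) => ->.
by rewrite meval0 eqxx.
Qed.

Lemma has_values_ext f u v : u =1 v -> has_values f u -> has_values f v.
Proof. by move=> uv [n [d [-> nd]]]; exists n, d; split=> // z; rewrite -uv. Qed.

Lemma has_values_poly p : has_values (ratpoly p) (fun z => p.@[coords z]).
Proof.
exists p, 1; split; first by rewrite [ratpoly 1]tofrac1 divr1.
by move=> z; rewrite meval1 oner_eq0 divr1.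
Qed.

Lemma has_valuesC (c : R) : has_values (ratC c) (fun=> c).
Proof.
by apply: has_values_ext (has_values_poly _) => z; rewrite mevalC.
Qed.

Lemma has_valuesX : has_values ratX (@xcoord R).
Proof. by apply: has_values_ext (has_values_poly _) => z; rewrite mevalXU. Qed.

Lemma has_valuesY : has_values ratY (@ycoord R).
Proof. by apply: has_values_ext (has_values_poly _) => z; rewrite mevalXU. Qed.

Lemma has_valuesD f g u v : has_values f u -> has_values g v ->
  has_values (f + g) (fun z => u z + v z).
Proof.
move=> [n [d [-> nd]]] [n' [d' [-> nd']]].
have [h h'] : ratpoly d != 0 /\ ratpoly d' != 0.
  by split; apply: den_neq0 => z; case: (nd z); case: (nd' z).
exists (n * d' + n' * d), (d * d'); split.
  by rewrite !(ratpolyD, ratpolyM) addf_div.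
move=> z; have [e ->] := nd z; have [e' ->] := nd' z.
by rewrite mevalD !mevalM mulf_neq0 // addf_div.
Qed.

Lemma has_valuesM f g u v : has_values f u -> has_values g v ->
  has_values (f * g) (fun z => u z * v z).
Proof.
move=> [n [d [-> nd]]] [n' [d' [-> nd']]]; exists (n * n'), (d * d').
split; first by rewrite !ratpolyM mulf_div.
move=> z; have [e ->] := nd z; have [e' ->] := nd' z.
by rewrite !mevalM mulf_neq0 // mulf_div.
Qed.

Lemma has_valuesV f u : (forall z, u z != 0) -> has_values f u ->
  has_values f^-1 (fun z => (u z)^-1).
Proof.
move=> u0 [n [d [-> nd]]]; exists d, n; rewrite invf_div; split=> // z.
have [e uz] := nd z; rewrite uz invf_div; split=> //.
by have := u0 z; rewrite uz; apply: contraNneq => ->; rewrite mul0r.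
Qed.

Lemma has_values_eq f g u v : has_values f u -> has_values g v ->
  (f = g <-> u =1 v).
Proof.
move=> [n [d [-> nd]]] [n' [d' [-> nd']]].
have [h h'] : ratpoly d != 0 /\ ratpoly d' != 0.
  by split; apply: den_neq0 => z; case: (nd z); case: (nd' z).
split=> [/eqP|uv].
  rewrite eqr_div // -!ratpolyM => /eqP/ratpoly_inj e z.
  have [dz ->] := nd z; have [dz' ->] := nd' z; apply/eqP.
  by rewrite eqr_div // -!mevalM e.
apply/eqP; rewrite eqr_div // -!ratpolyM; apply/eqP; congr ratpoly.
apply/eqP; rewrite -subr_eq0; apply/eqP/mpoly_eq0_quadrant => z.
have [dz uz] := nd z; have [dz' vz] := nd' z; move: (uv z).
rewrite uz vz => /eqP; rewrite eqr_div // => /eqP e.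
by rewrite mevalB !mevalM e subrr.
Qed.

(** Surjectivity makes the pullback of functions injective, hence makes
    substitution by phi well defined on all rational functions. *)
Definition acts_as phi (F : quadrant R -> quadrant R) : Prop :=
  [/\ forall w, exists z, F z = w,
      has_values phi.1 (fun z => xcoord (F z)) &
      has_values phi.2 (fun z => ycoord (F z))].

Let ratC_zmod : zmod_morphism (@ratC R).
Proof. by move=> c d; rewrite /ratC /ratpoly -tofracB -mpolyCB. Qed.

Let ratC_monoid : monoid_morphism (@ratC R).
Proof.
split=> [|c d]; first by rewrite /ratC mpolyC1 /ratpoly tofrac1.
by rewrite /ratC /ratpoly -tofracM -mpolyCM.
Qed.

HB.instance Definition _ :=
  GRing.isZmodMorphism.Build R (ratfun R) (@ratC R) ratC_zmod.
HB.instance Definition _ :=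
  GRing.isMonoidMorphism.Build R (ratfun R) (@ratC R) ratC_monoid.

Lemma polysubstM phi p q :
  polysubst phi (p * q) = polysubst phi p * polysubst phi q.
Proof. exact: rmorphM. Qed.

Lemma has_values_polysubst phi F p : acts_as phi F ->
  has_values (polysubst phi p) (fun z => p.@[coords (F z)]).
Proof.
move=> [_ X Y].
have eval z : p.@[coords (F z)] = \sum_(m <- msupp p)
   p@_m * (xcoord (F z) ^+ m ord0 * ycoord (F z) ^+ m (lift ord0 ord0)).
  rewrite mevalE; apply: eq_bigr => m _.
  by rewrite !big_ord_recl big_ord0 mulr1.
apply: (has_values_ext (fun z => esym (eval z))).
have pow f u k : has_values f u -> has_values (f ^+ k) (fun z => u z ^+ k).
  move=> fu; elim: k => [|k IH].
    have := has_valuesC 1; rewrite /ratC mpolyC1 [ratpoly 1]tofrac1.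
    by apply: has_values_ext.
  rewrite exprS; apply: has_values_ext (has_valuesM fu IH) => z.
  by rewrite exprS.
rewrite /polysubst /mmap.
elim: (msupp p) => [|m s IH].
  rewrite big_nil; have := has_valuesC 0; rewrite raddf0.
  by apply: has_values_ext => z; rewrite big_nil.
rewrite big_cons.
have h : has_values (ratC p@_m *
    mmap1 (fun i : 'I_2 => if i == 0 then phi.1 else phi.2) m)
    (fun z => p@_m *
      (xcoord (F z) ^+ m ord0 * ycoord (F z) ^+ m (lift ord0 ord0))).
  rewrite /mmap1 !big_ord_recl big_ord0 mulr1.
  apply: has_valuesM (has_valuesC _) _.
  by apply: has_valuesM; apply: pow.
by apply: has_values_ext (has_valuesD h IH) => z; rewrite big_cons.
Qed.

(** A polynomial killed by the substitution vanishes on the image of F, which is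
    the whole quadrant. *)
Lemma polysubst_eq0 phi F p : acts_as phi F -> polysubst phi p = 0 -> p = 0.
Proof.
move=> phiF p0; have [surj _ _] := phiF; apply: mpoly_eq0_quadrant => w.
have [z <-] := surj w; have := has_values_polysubst p phiF; rewrite p0.
have /has_values_eq h := has_valuesC 0; move/h => [+ _].
by rewrite raddf0 => /(_ erefl) /(_ z) <-.
Qed.

Lemma ratsubst_div phi F n d : acts_as phi F -> d != 0 ->
  ratsubst phi (ratpoly n / ratpoly d) = polysubst phi n / polysubst phi d.
Proof.
move=> phiF d0; rewrite /ratsubst; set f := ratpoly n / ratpoly d.
set r := repr _; have r0 : \d_r != 0 by [].
have fr : f = ratpoly \n_r / ratpoly \d_r.
  exact: frac_repr.
have e : n * \d_r = \n_r * d.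
  apply: ratpoly_inj; move/eqP: fr; rewrite /f eqr_div ?ratpoly_eq0 //.
  by rewrite -!ratpolyM => /eqP.
apply/eqP; rewrite eqr_div; last 2 first.
- by apply: contraNneq r0 => /(polysubst_eq0 phiF) ->.
- by apply: contraNneq d0 => /(polysubst_eq0 phiF) ->.
by rewrite -!polysubstM e.
Qed.

(** Substitution by phi is a morphism of fields, so it has no kernel. *)
Lemma ratsubst_inj phi F : acts_as phi F -> injective (ratsubst phi).
Proof.
move=> phiF f g; rewrite [f]frac_repr [g]frac_repr.
set r := repr f; set s := repr g.
have r0 : \d_r != 0 by []; have s0 : \d_s != 0 by [].
rewrite !(ratsubst_div _ phiF) // => /eqP.
rewrite eqr_div; last 2 first.
- by apply: contraNneq r0 => /(polysubst_eq0 phiF) ->.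
- by apply: contraNneq s0 => /(polysubst_eq0 phiF) ->.
rewrite -!polysubstM -subr_eq0 -raddfB => /eqP/(polysubst_eq0 phiF)/eqP.
rewrite subr_eq0 => /eqP e; apply/eqP.
by rewrite eqr_div ?tofrac_eq0 // -!ratpolyM e.
Qed.

Lemma has_values_ratsubst phi F f u : acts_as phi F -> has_values f u ->
  has_values (ratsubst phi f) (fun z => u (F z)).
Proof.
move=> phiF [n [d [-> nd]]].
have d0 : d != 0.
  apply: contraTneq (proj1 (nd (unit_point R))) => ->.
  by rewrite meval0 eqxx.
rewrite (ratsubst_div _ phiF d0).
have h := has_valuesM (has_values_polysubst n phiF)
  (has_valuesV _ (has_values_polysubst d phiF)).
apply: has_values_ext (h _) => z; last by case: (nd (F z)).
by case: (nd (F z)).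
Qed.

Lemma acts_as_id : acts_as rat_id id.
Proof.
by split; [move=> w; exists w|exact: has_valuesX|exact: has_valuesY].
Qed.

Lemma acts_as_comp phi psi F G : acts_as phi F -> acts_as psi G ->
  acts_as (rat_comp phi psi) (F \o G).
Proof.
move=> [sF XF YF] psiG; split.
- move=> w; have [z <-] := sF w; have [sG _ _] := psiG.
  by have [t <-] := sG z; exists t.
- exact: has_values_ratsubst psiG XF.
- exact: has_values_ratsubst psiG YF.
Qed.

Lemma acts_as_eq phi psi F G : acts_as phi F -> acts_as psi G ->
  (phi = psi <-> F =1 G).
Proof.
move=> [_ XF YF] [_ XG YG]; split=> [e z|e].
  by apply: quadrant_eq;
    [move: (has_values_eq XF XG)|move: (has_values_eq YF YG)];
    rewrite e => -[/(_ erefl)].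
rewrite [phi]surjective_pairing [psi]surjective_pairing; congr pair.
  by apply/(has_values_eq XF XG) => z; rewrite e.
by apply/(has_values_eq YF YG) => z; rewrite e.
Qed.

(** Nothing is known about how psi acts on the quadrant, and none of the usual
    associativity arguments apply to it; but substitution by phi is injective
    and sends the components of psi and of chi to the same coordinates. *)
Lemma rat_inverse_unique phi F psi chi G : acts_as phi F -> acts_as chi G ->
  cancel F G -> rat_inverse phi psi -> psi = chi.
Proof.
move=> phiF chiG FG [_].
have -> : rat_id = rat_comp chi phi.
  by apply/(acts_as_eq acts_as_id (acts_as_comp chiG phiF)) => z; rewrite /= FG.
move=> [/(ratsubst_inj phiF) e1 /(ratsubst_inj phiF) e2].
by rewrite [psi]surjective_pairing e1 e2 -surjective_pairing.
Qed.

Lemma rat_inverse_acts phi F psi G : acts_as phi F -> acts_as psi G ->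
  cancel F G -> cancel G F -> rat_inverse phi psi.
Proof.
move=> phiF psiG FG GF; split.
  by apply/(acts_as_eq (acts_as_comp phiF psiG) acts_as_id) => z /=.
by apply/(acts_as_eq (acts_as_comp psiG phiF) acts_as_id) => z /=.
Qed.

End Values.

(** The rotations are the powers of phi1 phi2, and the reflections are the
    composites of a rotation after phi1. *)
Section Dihedral.
Local Open Scope classical_set_scope.
Variables (R : realType) (phi1 phi2 : ratmap R).
Variables (f1 f2 : quadrant R -> quadrant R).
Hypotheses (phi1E : acts_as phi1 f1) (phi2E : acts_as phi2 f2).
Hypotheses (f1K : involutive f1) (f2K : involutive f2).
Hypotheses (f1_id : ~ f1 =1 id) (f2_id : ~ f2 =1 id).

Local Notation rho := (f1 \o f2).
Local Notation generated := (smallest (@birational_subgroup R) [set phi1; phi2]).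

Let rot k : ratmap R := iter k (rat_comp (rat_comp phi1 phi2)) rat_id.
Let refl k : ratmap R := rat_comp (rot k) phi1.

Let rotE k : acts_as (rot k) (iter k rho).
Proof.
elim: k => [|k IH]; first exact: acts_as_id.
exact: acts_as_comp (acts_as_comp phi1E phi2E) IH.
Qed.

Let reflE k : acts_as (refl k) (iter k rho \o f1).
Proof. exact: acts_as_comp (rotE k) phi1E. Qed.

Let generated_rot k : generated (rot k).
Proof.
move=> H [[_ H1 Hc _] gens].
have H12 : H (rat_comp phi1 phi2) by apply: Hc; apply: gens; [left|right].
by elim: k => [//|k IH]; apply: Hc.
Qed.

Let generated_refl k : generated (refl k).
Proof.
move=> H sH; have := generated_rot k sH; case: sH => [[_ _ Hc _] gens] h.
by apply: Hc => //; apply: gens; left.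
Qed.

Let rho_inj : injective rho.
Proof. exact: inj_comp (can_inj f1K) (can_inj f2K). Qed.

Let iter_rho_inj n : injective (iter n rho).
Proof. by elim: n => //= n IH x y /rho_inj/IH. Qed.

Let iter_sub m n : (m <= n)%N -> iter m rho =1 iter n rho ->
  iter (n - m) rho =1 id.
Proof.
by move=> mn e z; apply: (@iter_rho_inj m); rewrite -iterD subnKC // -e.
Qed.

Section FiniteOrder.
Variables (k : nat) (k_gt0 : (0 < k)%N).
Hypothesis rho_k : iter k rho =1 id.
Hypothesis rho_min : forall j, (0 < j < k)%N -> ~ iter j rho =1 id.

Let iter_modn n : iter n rho =1 iter (n %% k) rho.
Proof.
move=> z; rewrite {1}(divn_eq n k) addnC iterD iterM; congr iter.
by elim: (n %/ k)%N z => //= m IH z; rewrite IH rho_k.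
Qed.

(** A reflection conjugates a rotation to its inverse, and the inverse of rho is
    rho^(k-1), which avoids negative exponents. *)
Let conj_iter n : f1 \o iter n rho =1 iter (n * k.-1) rho \o f1.
Proof.
move=> z /=.
have inv w : f2 (f1 w) = iter k.-1 rho w.
  by rewrite -{1}(rho_k w) -{1}(prednK k_gt0) iterS /= f1K f2K.
by rewrite iterM; elim: n => //= n <-; rewrite -inv !f1K.
Qed.

Let dihedral : set (ratmap R) :=
  [set phi | exists n, phi = rot n \/ phi = refl n].

Let dihedral_acts phi : dihedral phi -> exists F,
  acts_as phi F /\ exists n, F =1 iter n rho \/ F =1 iter n rho \o f1.
Proof.
by case=> n [] ->; [exists (iter n rho)|exists (iter n rho \o f1)]; split;
  rewrite //; exists n; [left|right].
Qed.

Let in_dihedral phi F n : acts_as phi F ->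
  F =1 iter n rho \/ F =1 iter n rho \o f1 -> dihedral phi.
Proof.
move=> phiF [e|e]; exists n; [left|right].
  exact/(acts_as_eq phiF (rotE n)).
exact/(acts_as_eq phiF (reflE n)).
Qed.

Let iter_inv n w : iter (n * k.-1) rho (iter n rho w) = w.
Proof.
rewrite -iterD -mulnSr prednK // iterM.
by elim: n w => //= m IH w; rewrite IH rho_k.
Qed.

(** Every rotation is inverted by another rotation, every reflection by
    itself. *)
Let dihedral_inverse phi : dihedral phi -> exists2 psi, dihedral psi &
  exists F, exists G, [/\ acts_as phi F, acts_as psi G, cancel F G & cancel G F].
Proof.
case=> n [] ->; [exists (rot (n * k.-1))|exists (refl n)].
- by exists (n * k.-1)%N; left.
  exists (iter n rho), (iter (n * k.-1) rho); split=> // w.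
  by rewrite -iterD addnC iterD iter_inv.
- by exists n; right.
have c w : iter n rho (f1 (iter n rho (f1 w))) = w.
  have /= -> := conj_iter n (f1 w).
  by rewrite f1K -iterD addnC iterD iter_inv.
by exists (iter n rho \o f1), (iter n rho \o f1); split.
Qed.

Let dihedral_subgroup : birational_subgroup dihedral.
Proof.
split.
- move=> phi /dihedral_inverse[psi _ [F [G [phiF psiG FG GF]]]].
  by exists psi; exact: rat_inverse_acts phiF psiG FG GF.
- by exists 0; left.
- move=> phi psi /dihedral_acts[F [phiF [n nF]]].
  move=> /dihedral_acts[G [psiG [m mG]]].
  have FG := acts_as_comp phiF psiG; case: nF mG => nF [] mG.
  + apply: (in_dihedral FG (n := n + m)); left => z /=.
    by rewrite nF mG iterD.
  + apply: (in_dihedral FG (n := n + m)); right => z /=.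
    by rewrite nF mG /= iterD.
  + apply: (in_dihedral FG (n := n + m * k.-1)); right => z /=.
    by rewrite nF mG /= iterD -[iter (m * _) _ _]conj_iter.
  + apply: (in_dihedral FG (n := n + m * k.-1)); left => z /=.
    by rewrite nF mG /= iterD; have /= -> := conj_iter m (f1 z); rewrite f1K.
- move=> phi psi /dihedral_inverse[chi Hchi [F [G [phiF chiG FG GF]]]] inv.
  by rewrite (rat_inverse_unique phiF chiG FG inv).
Qed.

Let iter_inj m n : (m <= n < k)%N -> iter m rho =1 iter n rho -> m = n.
Proof.
case/andP=> mn nk e; apply/eqP; rewrite eqn_leq mn leqNgt; apply/negP => lt.
by apply: (rho_min (j := n - m)) (iter_sub mn e); rewrite subn_gt0 lt; lia.
Qed.

(** If a reflection were a rotation, then so would be f1; as f1 inverts rho and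
    commutes with it, rho would have order at most two, and then f1 or f2 would
    be the identity. *)
Let iter_refl m n : ~ iter m rho =1 iter n rho \o f1.
Proof.
move=> e; have f1E : f1 =1 iter ((n * k.-1 + m) %% k) rho.
  by move=> z; rewrite -iter_modn iterD e /= iter_inv.
have k2 : (k <= 2)%N.
  rewrite leqNgt; apply/negP => k2; apply: (rho_min (j := 2)) => // z /=.
  have c w : f1 (rho w) = rho (f1 w) by rewrite !f1E -iterSr.
  by rewrite -[LHS]/(rho (f1 (f2 z))) -c /= f1K f2K.
have := ltn_pmod (n * k.-1 + m) k_gt0; move: f1E.
case: (_ %% k)%N => [|[|j]] f1E lt; last by lia.
  exact: f1_id f1E.
by apply: f2_id => z; apply: (can_inj f1K); rewrite -[LHS]/(iter 1 rho z) -f1E.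
Qed.

(** The k rotations and k reflections form a birational subgroup, hence are all
    of the generated one, and they are pairwise distinct. *)
Lemma card_dihedral : (generated #= `I_(k.*2))%card.
Proof.
pose elt i := if (i < k)%N then rot i else refl (i - k).
have -> : generated = elt @` `I_(k.*2).
  apply/seteqP; split; last first.
    move=> _ [i _ <-]; rewrite /elt.
    by case: ifP => _; [exact: generated_rot|exact: generated_refl].
  have sub : dihedral `<=` elt @` `I_(k.*2).
    move=> phi [n [] ->]; have := ltn_pmod n k_gt0 => nk.
      exists (n %% k)%N; first by rewrite /=; lia.
      rewrite /elt nk; apply/(acts_as_eq (rotE _) (rotE _)) => z.
      by rewrite -iter_modn.
    exists (k + n %% k)%N; first by rewrite /=; lia.
    rewrite /elt ltnNge leq_addr /= addKn.
    by apply/(acts_as_eq (reflE _) (reflE _)) => z /=; rewrite -iter_modn.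
  apply: subset_trans sub; apply: smallest_sub; first exact: dihedral_subgroup.
  move=> _ [->|->].
    by apply: (in_dihedral (n := 0) phi1E); right.
  apply: (in_dihedral (n := k.-1) phi2E); right => z /=.
  apply: rho_inj; rewrite -[RHS]/(iter k.-1.+1 rho (f1 z)) prednK // rho_k.
  by rewrite /= f2K.
apply: inj_card_eq => i j; rewrite !inE /= => ik jk.
wlog ij : i j ik jk / (i <= j)%N.
  by move=> h; case: (leqP i j) => [|/ltnW] ij e; [|symmetry]; apply: h.
rewrite /elt; case: ltnP => ik'; case: ltnP => jk'.
- move/(acts_as_eq (rotE _) (rotE _)) => e; apply: iter_inj e.
  by rewrite ij.
- by move/(acts_as_eq (rotE _) (reflE _))/iter_refl.
- by lia.
- move/(acts_as_eq (reflE _) (reflE _)) => e.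
  suff : (i - k = j - k)%N by lia.
  apply: iter_inj => [|z]; first by lia.
  by rewrite -[z]f1K; apply: e.
Qed.

End FiniteOrder.

(** Finiteness gives two equal powers of rho by the pigeonhole principle, hence a
    least k > 0 with rho^k = 1, and the group has order 2k. *)
Lemma card_generated_six : ~ rho =1 id ->
  (generated #= `I_6)%card <-> iter 3 rho =1 id.
Proof.
move=> neq12.
have min_order n : (0 < n)%N -> iter n rho =1 id ->
    exists2 k, (0 < k <= n)%N &
    iter k rho =1 id /\ forall j, (0 < j < k)%N -> ~ iter j rho =1 id.
  move=> n0 rn.
  have ex : exists m, (0 < m)%N && `[< iter m rho =1 id >].
    by exists n; rewrite n0; apply/asboolP.
  case: (ex_minnP ex) => k /andP[k0 /asboolP rk] kmin; exists k.
    by rewrite k0 kmin // n0; apply/asboolP.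
  split=> // j /andP[j0 jk] /asboolP rj; have := kmin j.
  by rewrite j0 rj leqNgt jk => /(_ isT).
split=> [six|r3].
  have [m [n [mn e]]] : exists m n, (m < n)%N /\ rot m = rot n.
    apply: contrapT => nex; apply: infinite_nat.
    have inj : injective rot.
      move=> m n e; apply: contrapT => /eqP.
      by rewrite neq_ltn => /orP[] lt; apply: nex; [exists m, n|exists n, m].
    have /card_eqPle[_ le] := inj_card_eq (A := setT) (in2W inj).
    apply: card_le_finite le _; apply: (@sub_finite_set _ _ generated).
      by move=> _ [i _ <-]; exact: generated_rot.
    by apply/finite_setP; exists 6.
  have {}e := proj1 (acts_as_eq (rotE m) (rotE n)) e.
  have [k /andP[k0 _] [rk kmin]] :
    exists2 k, (0 < k <= n - m)%N & iter k rho =1 id /\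
      forall j, (0 < j < k)%N -> ~ iter j rho =1 id.
    by apply: min_order; [rewrite subn_gt0|exact: iter_sub (ltnW mn) e].
  have k3 : k = 3%N.
    have c := card_dihedral k0 rk kmin.
    have : (`I_(k.*2) #= `I_6)%card.
      by apply: card_eq_trans six; rewrite card_eq_sym.
    by move/card_eq_II => /(congr1 half); rewrite doubleK.
  by move: rk; rewrite k3.
have [k /andP[k0 k3] [rk kmin]] := min_order 3 isT r3.
suff -> : 6%N = k.*2 by exact: card_dihedral k0 rk kmin.
case: k k0 k3 rk kmin => [|[|[|[|k]]]] //= _ _ rk _.
case: neq12 => z; have := r3 z; rewrite -[LHS]/(iter 2 rho (rho z)) => e.
by rewrite -[RHS]e; exact/esym/rk.
Qed.

End Dihedral.

(** * The group of a walk acting on the positive quadrant *)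

Section Hexagon.
Variable R : realType.
Implicit Types (P Q : 'M[R]_3) (x y a b c : R) (F G : R -> R).

Definition quad a b c x : R := a * x ^+ 2 + b * x + c.

Lemma quad_gt0 a b c x : 0 <= a -> 0 <= b -> 0 <= c ->
  [|| a != 0, b != 0 | c != 0] -> 0 < x -> 0 < quad a b c x.
Proof.
move=> a0 b0 c0 abc x0.
have ax : 0 <= a * x ^+ 2 by rewrite mulr_ge0 // exprn_ge0 // ltW.
have bx : 0 <= b * x by rewrite mulr_ge0 // ltW.
rewrite lt_neqAle !addr_ge0 // andbT eq_sym.
apply: contraTneq abc => /eqP; rewrite /quad !paddr_eq0 ?addr_ge0 //.
rewrite !mulf_eq0 (gt_eqF x0) !orbF => /andP[/andP[/eqP-> /eqP->] /eqP->].
by rewrite eqxx.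
Qed.

(** This is C1/A1 at height y, after clearing the powers of y: the product of
    the abscissae of two points exchanged by phi1. *)
Definition xprod P y : R :=
  quad (P 2 0) (P 2 1) (P 2 2) y / quad (P 0 0) (P 0 1) (P 0 2) y.

Definition yprod P : R -> R := xprod P^T.

Definition walk_matrix P : Prop :=
  [/\ forall i j, 0 <= P i j,
      [|| P 0 0 != 0, P 0 1 != 0 | P 0 2 != 0],
      [|| P 2 0 != 0, P 2 1 != 0 | P 2 2 != 0],
      [|| P 0 0 != 0, P 1 0 != 0 | P 2 0 != 0] &
      [|| P 0 2 != 0, P 1 2 != 0 | P 2 2 != 0]].

Lemma walk_matrix_tr P : walk_matrix P -> walk_matrix P^T.
Proof. by case=> p0 *; split; rewrite ?mxE // => i j; rewrite mxE. Qed.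

Lemma xprod_gt0 P y : walk_matrix P -> 0 < y -> 0 < xprod P y.
Proof. by case=> p0 p1 p2 _ _ y0; rewrite divr_gt0 ?quad_gt0. Qed.

Lemma yprod_gt0 P x : walk_matrix P -> 0 < x -> 0 < yprod P x.
Proof. by move/walk_matrix_tr; exact: xprod_gt0. Qed.

(** From (x, y), go to x1 = F(y)/x and y1 = G(x1)/y on one side, and to
    y2 = G(x)/y and x2 = F(y2)/x on the other; the equation says that x1 x2 =
    F(y1), so that (x1, y1) and (x2, y1) are exchanged by phi1. *)
Definition hexagon_closes F G : Prop := forall x y, 0 < x -> 0 < y ->
  F (G (F y / x) / y) = F y / x * (F (G x / y) / x).

Definition hexagonal P : Prop :=
  hexagon_closes (xprod P) (yprod P) /\ hexagon_closes (yprod P) (xprod P).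

Lemma hexagonal_tr P : hexagonal P -> hexagonal P^T.
Proof. by case=> h1 h2; split; rewrite /yprod trmxK. Qed.

Section WalkMaps.
Variables (P : 'M[R]_3) (P_walk : walk_matrix P).

Definition flip_x (z : quadrant R) :=
  qpoint (xprod P (ycoord z) / xcoord z) (ycoord z).
Definition flip_y (z : quadrant R) :=
  qpoint (xcoord z) (yprod P (xcoord z) / ycoord z).

Let flip_xE z :
  xcoord (flip_x z) = xprod P (ycoord z) / xcoord z /\
  ycoord (flip_x z) = ycoord z.
Proof.
have h : 0 < xprod P (ycoord z) / xcoord z.
  by rewrite divr_gt0 ?xcoord_gt0 // xprod_gt0 // ycoord_gt0.
by rewrite xcoord_qpoint ?ycoord_qpoint // ycoord_gt0.
Qed.

Let flip_yE z :
  xcoord (flip_y z) = xcoord z /\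
  ycoord (flip_y z) = yprod P (xcoord z) / ycoord z.
Proof.
have h : 0 < yprod P (xcoord z) / ycoord z.
  by rewrite divr_gt0 ?ycoord_gt0 // yprod_gt0 // xcoord_gt0.
by rewrite xcoord_qpoint ?ycoord_qpoint // xcoord_gt0.
Qed.

Lemma flip_xK : involutive flip_x.
Proof.
move=> z; have [h1 h2] := flip_xE (flip_x z); have [h3 h4] := flip_xE z.
apply: quadrant_eq; rewrite ?h1 ?h2 ?h4 // h3 invf_div mulrC divfK //.
by rewrite gt_eqF // xprod_gt0 // ycoord_gt0.
Qed.

Lemma flip_yK : involutive flip_y.
Proof.
move=> z; have [h1 h2] := flip_yE (flip_y z); have [h3 h4] := flip_yE z.
apply: quadrant_eq; rewrite ?h1 ?h2 ?h3 // h4 invf_div mulrC divfK //.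
by rewrite gt_eqF // yprod_gt0 // xcoord_gt0.
Qed.

Let has_values_row (a b c : R) (t : ratfun R) (u : quadrant R -> R) :
  (forall z, 0 < u z) -> has_values t u ->
  has_values (t * ratC a + ratC b + ratC c / t) (fun z => quad a b c (u z) / u z).
Proof.
move=> u0 tu; have u_neq0 z : u z != 0 by rewrite gt_eqF.
have h1 := has_valuesM tu (has_valuesC a).
have h2 := has_valuesM (has_valuesC c) (has_valuesV u_neq0 tu).
apply: has_values_ext (has_valuesD (has_valuesD h1 (has_valuesC b)) h2) => z.
by rewrite /quad; field.
Qed.

Let A1E : A1 P = ratY * ratC (P 0 0) + ratC (P 0 1) + ratC (P 0 2) / ratY.
Proof. exact: sum_step. Qed.
Let C1E : C1 P = ratY * ratC (P 2 0) + ratC (P 2 1) + ratC (P 2 2) / ratY.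
Proof. exact: sum_step. Qed.
Let A2E : A2 P = ratX * ratC (P 0 0) + ratC (P 1 0) + ratC (P 2 0) / ratX.
Proof. exact: sum_step. Qed.
Let C2E : C2 P = ratX * ratC (P 0 2) + ratC (P 1 2) + ratC (P 2 2) / ratX.
Proof. exact: sum_step. Qed.

Let has_values_quotient (a b c a' b' c' : R) (s t : ratfun R)
  (u v : quadrant R -> R) :
  (forall z, 0 < u z) -> (forall z, 0 < v z) ->
  (forall y, 0 < y -> 0 < quad a b c y) ->
  has_values s u -> has_values t v ->
  has_values ((t * ratC a' + ratC b' + ratC c' / t) /
              (s * (t * ratC a + ratC b + ratC c / t)))
    (fun z => quad a' b' c' (v z) / quad a b c (v z) / u z).
Proof.
move=> u0 v0 q0 su tv.
have h := has_valuesM su (has_values_row a b c v0 tv).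
have h0 z : u z * (quad a b c (v z) / v z) != 0.
  by rewrite gt_eqF // mulr_gt0 // divr_gt0 // q0.
apply: has_values_ext (has_valuesM (has_values_row a' b' c' v0 tv)
  (has_valuesV h0 h)) => z.
have [uz vz qz] : [/\ u z != 0, v z != 0 & quad a b c (v z) != 0].
  by split; rewrite gt_eqF // q0.
by field; rewrite uz vz qz.
Qed.

Lemma phi1_acts : acts_as (phi1 P) flip_x.
Proof.
have [p0 p1 p2 _ _] := P_walk; split.
- by move=> w; exists (flip_x w); rewrite flip_xK.
- rewrite /= C1E A1E.
  have h : has_values _ _ := has_values_quotient (P 2 0) (P 2 1) (P 2 2)
    (@xcoord_gt0 R) (@ycoord_gt0 R) (fun y => @quad_gt0 (P 0 0) (P 0 1) (P 0 2) y
      (p0 _ _) (p0 _ _) (p0 _ _) p1) (has_valuesX R) (has_valuesY R).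
  by apply: has_values_ext h => z; rewrite (proj1 (flip_xE z)).
- by apply: has_values_ext (has_valuesY R) => z; rewrite (proj2 (flip_xE z)).
Qed.

Lemma phi2_acts : acts_as (phi2 P) flip_y.
Proof.
have [p0 _ _ p1 p2] := P_walk; split.
- by move=> w; exists (flip_y w); rewrite flip_yK.
- by apply: has_values_ext (has_valuesX R) => z; rewrite (proj1 (flip_yE z)).
- rewrite /= C2E A2E.
  have h : has_values _ _ := has_values_quotient (P 0 2) (P 1 2) (P 2 2)
    (@ycoord_gt0 R) (@xcoord_gt0 R) (fun y => @quad_gt0 (P 0 0) (P 1 0) (P 2 0) y
      (p0 _ _) (p0 _ _) (p0 _ _) p1) (has_valuesY R) (has_valuesX R).
  apply: has_values_ext h => z; rewrite (proj2 (flip_yE z)).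
  by rewrite /yprod /xprod !mxE.
Qed.

Let not_fixed y : 0 < y -> exists2 x, 0 < x & y / x != x.
Proof.
move=> y0; have [e|ne] := eqVneq (y / 1) 1; last by exists 1.
exists 2; rewrite ?ltr0n // -[y]divr1 e; apply/eqP; lra.
Qed.

Lemma flip_x_id : ~ flip_x =1 id.
Proof.
move=> e; have [x x0 /eqP[]] := not_fixed (xprod_gt0 P_walk ltr01).
have [h _] := flip_xE (qpoint x 1).
by move: h; rewrite e xcoord_qpoint // ycoord_qpoint.
Qed.

Lemma flip_y_id : ~ flip_y =1 id.
Proof.
move=> e; have [y y0 /eqP[]] := not_fixed (yprod_gt0 P_walk ltr01).
have [_ h] := flip_yE (qpoint 1 y).
by move: h; rewrite e xcoord_qpoint // ycoord_qpoint.
Qed.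

Lemma flips_neq : ~ flip_x \o flip_y =1 id.
Proof.
move=> e; have [y y0 /eqP[]] := not_fixed (yprod_gt0 P_walk ltr01).
have [_ h] := flip_yE (qpoint 1 y).
have [_ h'] := flip_xE (flip_y (qpoint 1 y)).
move: h'; rewrite -[flip_x _]/((flip_x \o flip_y) _) e h.
by rewrite xcoord_qpoint // ycoord_qpoint.
Qed.

(** For two involutions, (f1 f2)^3 = 1 is the braid relation f1 f2 f1 = f2 f1 f2;
    its two coordinates are the two hexagon equations. *)
Lemma hexagonal_order3 :
  iter 3 (flip_x \o flip_y) =1 id <-> hexagonal P.
Proof.
have X0 x y : 0 < x -> 0 < y -> 0 < xprod P y / x.
  by move=> x0 y0; apply: divr_gt0 => //; exact: xprod_gt0.
have Y0 x y : 0 < x -> 0 < y -> 0 < yprod P x / y.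
  by move=> x0 y0; apply: divr_gt0 => //; exact: yprod_gt0.
have braid : iter 3 (flip_x \o flip_y) =1 id <->
    forall z, flip_x (flip_y (flip_x z)) = flip_y (flip_x (flip_y z)).
  split=> h z; last by rewrite /= -h !flip_xK flip_yK.
  by have /= := h z => {1}<-; rewrite flip_xK flip_yK flip_xK.
rewrite braid; clear braid; split=> [h|[h1 h2] z].
  suff h12 x y : 0 < x -> 0 < y ->
      xprod P (yprod P (xprod P y / x) / y) =
        xprod P y / x * (xprod P (yprod P x / y) / x) /\
      yprod P (xprod P (yprod P x / y) / x) =
        yprod P x / y * (yprod P (xprod P y / x) / y).
    by split=> x y x0 y0; case: (h12 x y) => //; case: (h12 y x).
  move=> x0 y0; set x1 := xprod P y / x; set y2 := yprod P x / y.
  have x10 : 0 < x1 by exact: X0.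
  have y20 : 0 < y2 by exact: Y0.
  have y10 : 0 < yprod P x1 / y by exact: Y0.
  have x20 : 0 < xprod P y2 / x by exact: X0.
  have x20' : 0 < xprod P (yprod P x1 / y) / x1 by exact: X0.
  have y10' : 0 < yprod P (xprod P y2 / x) / y2 by exact: Y0.
  have := h (qpoint x y).
  rewrite /flip_x /flip_y !(xcoord_qpoint, ycoord_qpoint) // -/x1 -/y2 => e.
  have := congr1 (@ycoord R) e; have := congr1 (@xcoord R) e.
  rewrite !(xcoord_qpoint, ycoord_qpoint) // => ex ey.
  by split; [rewrite -ex|rewrite ey]; rewrite mulrCA divff ?mulr1 ?gt_eqF.
set x := xcoord z; set y := ycoord z.
have [x0 y0] : 0 < x /\ 0 < y by split; [exact: xcoord_gt0|exact: ycoord_gt0].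
set x1 := xprod P y / x; set y2 := yprod P x / y.
have x10 : 0 < x1 by exact: X0.
have y20 : 0 < y2 by exact: Y0.
have y10 : 0 < yprod P x1 / y by exact: Y0.
have x20 : 0 < xprod P y2 / x by exact: X0.
have x20' : 0 < xprod P (yprod P x1 / y) / x1 by exact: X0.
have y10' : 0 < yprod P (xprod P y2 / x) / y2 by exact: Y0.
rewrite /flip_x /flip_y !(xcoord_qpoint, ycoord_qpoint) // -/x -/y -/x1 -/y2.
congr qpoint.
  by have := h1 x y x0 y0; rewrite -/x1 -/y2 => ->;
    rewrite [LHS]mulrAC divff ?mul1r ?gt_eqF.
by have := h2 y x y0 x0; rewrite -/x1 -/y2 => ->;
  rewrite [RHS]mulrAC divff ?mul1r ?gt_eqF.
Qed.

Theorem order6_hexagonal : (walk_group P #= `I_6)%card <-> hexagonal P.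
Proof.
rewrite -hexagonal_order3; apply: card_generated_six.
- exact: phi1_acts.
- exact: phi2_acts.
- exact: flip_xK.
- exact: flip_yK.
- exact: flip_x_id.
- exact: flip_y_id.
- exact: flips_neq.
Qed.

End WalkMaps.
End Hexagon.

(** * The symmetries of the square *)

Section Symmetries.
Variable R : realType.
Implicit Types (P Q : 'M[R]_3) (x y a b c : R) (F G : R -> R).

Lemma rev_ord3 : [/\ rev_ord 0 = 2 :> 'I_3, rev_ord 1 = 1 :> 'I_3 &
  rev_ord 2 = 0 :> 'I_3].
Proof. by split; apply: val_inj. Qed.

Lemma quadV a b c x : 0 < x -> quad a b c x^-1 = quad c b a x / x ^+ 2.
Proof. by move=> x0; rewrite /quad; field; rewrite gt_eqF. Qed.

Lemma xprod_rows P y : xprod (rowsub (@rev_ord 3) P) y = (xprod P y)^-1.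
Proof. by have [h0 _ h2] := rev_ord3; rewrite /xprod !mxE h0 h2 invf_div. Qed.

Lemma xprod_cols P y : 0 < y ->
  xprod (colsub (@rev_ord 3) P) y = xprod P y^-1.
Proof.
move=> y0; have [h0 h1 h2] := rev_ord3.
rewrite /xprod !mxE h0 h1 h2 !quadV // invf_div mulrA divfK //.
by rewrite expf_neq0 // gt_eqF.
Qed.

Lemma trmx_rows P : (rowsub (@rev_ord 3) P)^T = colsub (@rev_ord 3) P^T.
Proof. by apply/matrixP => i j; rewrite !mxE. Qed.

Lemma trmx_cols P : (colsub (@rev_ord 3) P)^T = rowsub (@rev_ord 3) P^T.
Proof. by apply/matrixP => i j; rewrite !mxE. Qed.

Lemma walk_matrix_rows P : walk_matrix P -> walk_matrix (rowsub (@rev_ord 3) P).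
Proof.
have [h0 h1 h2] := rev_ord3.
case=> p0 p1 p2 p3 p4; split; rewrite ?mxE ?h0 ?h1 ?h2 //.
- by move=> i j; rewrite mxE.
- by case/or3P: p3 => ->; rewrite ?orbT.
- by case/or3P: p4 => ->; rewrite ?orbT.
Qed.

Lemma walk_matrix_cols P : walk_matrix P -> walk_matrix (colsub (@rev_ord 3) P).
Proof.
move=> /walk_matrix_tr/walk_matrix_rows/walk_matrix_tr.
by rewrite trmx_rows trmxK.
Qed.

(** The change of variable x |-> 1/x replaces F by 1/F and G by G(1/x). *)
Lemma hexagon_closes_inv F G F' G' :
  (forall x, 0 < x -> 0 < F x) -> (forall x, 0 < x -> 0 < G x) ->
  (forall x, F' x = (F x)^-1) -> (forall x, 0 < x -> G' x = G x^-1) ->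
  hexagon_closes F G /\ hexagon_closes G F ->
  hexagon_closes F' G' /\ hexagon_closes G' F'.
Proof.
move=> F0 G0 F'E G'E [h1 h2].
have e x z : F' z / x = (F z / x^-1)^-1 by rewrite F'E invf_div mulrC.
have F_gt0 x z : 0 < x -> 0 < z -> 0 < F z / x^-1.
  by move=> x0 z0; rewrite divr_gt0 ?F0 ?invr_gt0.
have G_gt0 x y : 0 < x -> 0 < y -> 0 < G x^-1 / y.
  by move=> x0 y0; rewrite divr_gt0 ?G0 ?invr_gt0.
split=> x y x0 y0.
  rewrite !e !G'E ?invr_gt0 ?F_gt0 // invrK F'E h1 ?invr_gt0 //.
  by rewrite invfM.
rewrite !e !G'E ?invr_gt0 ?F_gt0 ?G_gt0 // ?invrK.
by have := h2 x y^-1 x0; rewrite invrK invr_gt0 => ->.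
Qed.

Lemma hexagonal_rows P : walk_matrix P -> hexagonal P ->
  hexagonal (rowsub (@rev_ord 3) P).
Proof.
move=> Pw; apply: hexagon_closes_inv.
- by move=> y; exact: xprod_gt0.
- by move=> x; exact: yprod_gt0.
- exact: xprod_rows.
- by move=> x x0; rewrite /yprod trmx_rows xprod_cols.
Qed.

Lemma rowsub_revK P : rowsub (@rev_ord 3) (rowsub (@rev_ord 3) P) = P.
Proof. by apply/matrixP => i j; rewrite !mxE rev_ordK. Qed.

Lemma colsub_revK P : colsub (@rev_ord 3) (colsub (@rev_ord 3) P) = P.
Proof. by apply/matrixP => i j; rewrite !mxE rev_ordK. Qed.

Lemma hexagonal_cols P : walk_matrix P -> hexagonal P ->
  hexagonal (colsub (@rev_ord 3) P).
Proof.
move=> Pw Ph; rewrite -[colsub _ _]trmxK trmx_cols; apply: hexagonal_tr.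
by apply: hexagonal_rows; [exact: walk_matrix_tr|exact: hexagonal_tr].
Qed.

(** Each generator of the symmetry group is an involution of the matrices, so
    one implication suffices for each. *)
Lemma square_orbit_hexagonal P Q : square_orbit P Q -> walk_matrix P ->
  walk_matrix Q /\ (hexagonal Q <-> hexagonal P).
Proof.
move=> PQ Pw; elim: PQ => {Q} [|Q _ [Qw QP]|Q _ [Qw QP]|Q _ [Qw QP]].
- by [].
- have Q'w := walk_matrix_rows Qw; split=> //; rewrite -QP; split=> h.
    by rewrite -[Q]rowsub_revK; exact: hexagonal_rows.
  exact: hexagonal_rows.
- have Q'w := walk_matrix_cols Qw; split=> //; rewrite -QP; split=> h.
    by rewrite -[Q]colsub_revK; exact: hexagonal_cols.
  exact: hexagonal_cols.
- split; first exact: walk_matrix_tr.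
  rewrite -QP; split=> h; last exact: hexagonal_tr.
  by rewrite -[Q]trmxK; exact: hexagonal_tr.
Qed.

End Symmetries.

(** * The three families close the hexagon *)

Section Families.
Variable R : realType.
Implicit Types (P Q : 'M[R]_3) (F G : R -> R).

Lemma linear_closes F G (a b : R) : 0 < a -> 0 < b ->
  (forall y, 0 < y -> F y = a * y) -> (forall x, 0 < x -> G x = b * x) ->
  hexagon_closes F G.
Proof.
move=> a0 b0 FE GE x y x0 y0.
have h1 : 0 < a * y / x by rewrite !mulr_gt0 ?invr_gt0.
have h2 : 0 < b * x / y by rewrite !mulr_gt0 ?invr_gt0.
have h3 : 0 < b * (a * y / x) / y.
  by rewrite divr_gt0 // mulr_gt0.
rewrite (FE y) // (GE x) // (GE _ h1) (FE _ h2) (FE _ h3).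
by field; rewrite !gt_eqF.
Qed.

Lemma linear_hexagonal P (a b : R) : 0 < a -> 0 < b ->
  (forall y, 0 < y -> xprod P y = a * y) ->
  (forall x, 0 < x -> yprod P x = b * x) -> hexagonal P.
Proof.
move=> a0 b0 XE YE.
by split; [exact: linear_closes XE YE|exact: linear_closes YE XE].
Qed.

(** With x1 = a (y + e) / x one has G(x) + e y = (e/a) x (x + x1 + r), which is
    symmetric in x and x1 up to its factor x; the constant a e in G is what makes
    this factorization possible. *)
Lemma affine_hexagonal P (a e r : R) : 0 < a -> 0 < e -> 0 <= r ->
  (forall y, 0 < y -> xprod P y = a * (y + e)) ->
  (forall x, 0 < x -> yprod P x = e / a * (x ^+ 2 + r * x + a * e)) ->
  hexagonal P.
Proof.
move=> a0 e0 r0 XE YE.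
have X0 y : 0 < y -> 0 < a * (y + e) by move=> y0; rewrite mulr_gt0 // addr_gt0.
have Y0 x : 0 < x -> 0 < e / a * (x ^+ 2 + r * x + a * e).
  move=> x0; rewrite mulr_gt0 ?divr_gt0 // ltr_wpDl ?mulr_gt0 //.
  by rewrite addr_ge0 ?mulr_ge0 // ltW // exprn_gt0.
split=> x y x0 y0.
  have h1 : 0 < a * (y + e) / x by rewrite divr_gt0 ?X0.
  have h2 := divr_gt0 (Y0 _ x0) y0; have h3 := divr_gt0 (Y0 _ h1) y0.
  rewrite (XE y) // (YE x) // (YE _ h1) (XE _ h2) (XE _ h3).
  by field; rewrite !gt_eqF.
have h1 := divr_gt0 (Y0 _ y0) x0.
have h2 := divr_gt0 (X0 _ x0) y0; have h3 := divr_gt0 (X0 _ h1) y0.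
rewrite (YE y) // (XE x) // (XE _ h1) (YE _ h2) (YE _ h3).
by field; rewrite !gt_eqF.
Qed.

Lemma family_I_hexagonal P : walk_matrix P -> family_I P -> hexagonal P.
Proof.
move=> [p0 _ _ _ _] [p10 [p00 [p0m [pm1 [E]]]]].
rewrite !mulf_eq0 !negb_or => /andP[/andP[n1 n2] n3].
have [h1 h2 h3] : [/\ 0 < p10, 0 < p0m & 0 < pm1].
  by split; rewrite lt_neqAle eq_sym ?n1 ?n2 ?n3 /=;
    [have := p0 0 1|have := p0 1 2|have := p0 2 0]; rewrite E mxE.
apply: (linear_hexagonal (divr_gt0 h3 h1) (divr_gt0 h2 h3)) => t t0;
  rewrite /yprod /xprod E !mxE /quad /=; field; rewrite !gt_eqF //.
Qed.

Lemma family_II_hexagonal P : walk_matrix P -> family_II P -> hexagonal P.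
Proof.
move=> [p0 _ _ _ _] [p10 [p1m [p00 [p0m [pm1 [E]]]]]].
rewrite !mulf_eq0 !negb_or => /andP[/andP[n1 n2] n3].
have [h1 h2 h3 h4] : [/\ 0 < p10, 0 < p1m, 0 < pm1 & 0 <= p0m].
  by split; rewrite ?lt_neqAle 1?eq_sym ?n1 ?n2 ?n3 /=;
    [have := p0 0 1|have := p0 0 2|have := p0 2 0|have := p0 1 2];
    rewrite E mxE.
apply: (affine_hexagonal (divr_gt0 h3 h1) (divr_gt0 h2 h1)
  (divr_ge0 h4 (ltW h2))) => t t0.
  have s0 : 0 < p10 * t + p1m by rewrite addr_gt0 // mulr_gt0.
  rewrite /xprod E !mxE /quad /=; field.
  by rewrite !gt_eqF // mul0r add0r.
rewrite /yprod /xprod E !mxE /quad /=; field.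
by rewrite !gt_eqF.
Qed.

Lemma family_III_hexagonal P : walk_matrix P -> family_III P -> hexagonal P.
Proof.
move=> [p0 _ _ _ _] [p1m [p00 [p0m [pm1 [pm0 [E]]]]]].
rewrite !mulf_eq0 !negb_or => /andP[/andP[/andP[n1 n2] n3] n4].
have [h1 h2 h3 h4] : [/\ 0 < p1m, 0 < pm1, 0 < p0m & 0 < pm0].
  by split; rewrite ?lt_neqAle 1?eq_sym ?n1 ?n2 ?n3 ?n4 /=;
    [have := p0 0 2|have := p0 2 0|have := p0 1 2|have := p0 2 1];
    rewrite E mxE.
apply: (linear_hexagonal (divr_gt0 h4 h1) (divr_gt0 h3 h2)) => t t0.
  rewrite /xprod E !mxE /quad /=; field; rewrite n1 n4 /=.
  by rewrite -mulrA -mulrDr gt_eqF // mulr_gt0 // addr_gt0 // mulr_gt0.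
rewrite /yprod /xprod E !mxE /quad /=; field; rewrite n2 n3 /=.
by rewrite gt_eqF // addr_gt0 // !mulr_gt0.
Qed.

Lemma families_hexagonal P : walk_matrix P ->
  [\/ family_I P, family_II P | family_III P] -> hexagonal P.
Proof.
move=> Pw [] h; [exact: family_I_hexagonal|exact: family_II_hexagonal|].
exact: family_III_hexagonal.
Qed.

End Families.

(** * Comparison of leading coefficients *)

(** Positivity of expressions built without subtraction from positive atoms. *)
Ltac positivity :=
  repeat first [assumption | apply: addr_gt0 | apply: mulr_gt0
               | apply: exprn_gt0 | apply: divr_gt0 | exact: ltr0Sn].

Section LeadingTerms.
Variable R : realType.
Implicit Types (P Q : 'M[R]_3) (F G : R -> R).

Lemma sextic_top_coefs (c0 c1 c2 c3 c4 c5 c6 : R) :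
  (forall x, 0 < x -> c0 + c1 * x + c2 * x ^+ 2 + c3 * x ^+ 3 + c4 * x ^+ 4
     + c5 * x ^+ 5 + c6 * x ^+ 6 = 0) -> [/\ c4 = 0, c5 = 0 & c6 = 0].
Proof.
move=> h; have : Poly [:: c0; c1; c2; c3; c4; c5; c6] = 0.
  apply: poly_eq0_pos => x x0; rewrite horner_Poly /= -[RHS](h x x0).
  by ring.
move=> /polyP e; split.
- by have := e 4; rewrite coef_Poly coef0.
- by have := e 5; rewrite coef_Poly coef0.
- by have := e 6; rewrite coef_Poly coef0.
Qed.

(** After clearing denominators, the hexagon equation at a fixed height has this
    product form on both sides. *)
Lemma quartic_quadratic_top (a0 a1 a2 a3 a4 b0 b1 b2 : R)
    (a0' a1' a2' a3' a4' b0' b1' b2' : R) :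
  (forall x, 0 < x ->
    (a4 * x ^+ 4 + a3 * x ^+ 3 + a2 * x ^+ 2 + a1 * x + a0) * quad b2 b1 b0 x =
    (a4' * x ^+ 4 + a3' * x ^+ 3 + a2' * x ^+ 2 + a1' * x + a0')
      * quad b2' b1' b0' x) ->
  [/\ a4 * b2 = a4' * b2', a4 * b1 + a3 * b2 = a4' * b1' + a3' * b2' &
      a4 * b0 + a3 * b1 + a2 * b2 = a4' * b0' + a3' * b1' + a2' * b2'].
Proof.
move=> h.
have [] := @sextic_top_coefs (a0 * b0 - a0' * b0')
  (a0 * b1 + a1 * b0 - (a0' * b1' + a1' * b0'))
  (a0 * b2 + a1 * b1 + a2 * b0 - (a0' * b2' + a1' * b1' + a2' * b0'))
  (a1 * b2 + a2 * b1 + a3 * b0 - (a1' * b2' + a2' * b1' + a3' * b0'))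
  (a4 * b0 + a3 * b1 + a2 * b2 - (a4' * b0' + a3' * b1' + a2' * b2'))
  (a4 * b1 + a3 * b2 - (a4' * b1' + a3' * b2')) (a4 * b2 - a4' * b2').
  move=> x x0; have := h x x0; rewrite /quad => e.
  by apply/eqP; rewrite -subr_eq0 subr0; apply/eqP; move/eqP: e;
    rewrite -subr_eq0 => /eqP e; rewrite -[RHS]e; ring.
by move=> /eqP; rewrite subr_eq0 => /eqP-> /eqP; rewrite subr_eq0 => /eqP->
  /eqP; rewrite subr_eq0 => /eqP->.
Qed.

(** The relation al be = a c is automatic for a walk, where F and G share the
    corner weights.  Take the equation at y = a.  The coefficient of x^6 gives
    a c = b d, and once b is eliminated the coefficient of x^5 becomes a negative
    multiple of (d - c)^2. *)
Lemma closes_homographic F G (al be a b c d : R) :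
  0 < al -> 0 < be -> 0 < a -> 0 < b -> 0 < c -> 0 < d -> al * be = a * c ->
  (forall y, 0 < y -> F y = al * y * (y + b) / (y + a)) ->
  (forall x, 0 < x -> G x = be * x * (x + d) / (x + c)) ->
  hexagon_closes F G -> b = a /\ d = c.
Proof.
move=> al0 be0 a0 b0 c0 d0 alE FE GE h.
pose ph := al * (a + b) / 2.
have ph0 : 0 < ph by rewrite divr_gt0 // mulr_gt0 // addr_gt0.
have Fa : F a = ph by rewrite FE // /ph; field; lra.
(* The quartics are (x + d) (c x + ph) (N + a b M) and
   (d x + ph) (x + c) (N1 + a b M1), where N / M and N1 / M1 are the values of G
   at x and at ph / x; the quadratics are N1 + a^2 M1 and N + a^2 M. *)
have [] := @quartic_quadratic_top
  (d * ph * (a * b * c))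
  (d * ph * (be * d + a * b) + (ph + c * d) * (a * b * c))
  (c * (a * b * c) + (ph + c * d) * (be * d + a * b) + d * ph * be)
  (c * (be * d + a * b) + (ph + c * d) * be) (c * be)
  (be * ph ^+ 2) (be * ph * d + a ^+ 2 * ph) (a ^+ 2 * c)
  (c * ph * (be * ph ^+ 2))
  (c * ph * (be * ph * d + a * b * ph) + (ph + c * d) * (be * ph ^+ 2))
  (d * (be * ph ^+ 2) + (ph + c * d) * (be * ph * d + a * b * ph)
    + c * ph * (a * b * c))
  (d * (be * ph * d + a * b * ph) + (ph + c * d) * (a * b * c))
  (d * (a * b * c))
  (a ^+ 2 * c) (be * d + a ^+ 2) be.
  move=> x x0; have := h x a x0 a0; rewrite Fa.
  have p0 : 0 < ph / x by rewrite divr_gt0.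
  pose N := be * x * (x + d); pose M := x + c.
  pose N1 := be * ph * (ph + d * x); pose M1 := x * (ph + c * x).
  have [N0 M0 N10 M10] : [/\ 0 < N, 0 < M, 0 < N1 & 0 < M1].
    by split; rewrite /N /M /N1 /M1; positivity.
  have Gx : G x = N / M by rewrite GE.
  have Gx1 : G (ph / x) = N1 / M1.
    rewrite GE // /N1 /M1; field.
    by rewrite !gt_eqF //; positivity.
  have FG n m : 0 < n -> 0 < m -> F (n / m / a) =
      al * n * (n + a * b * m) / (a * m * (n + a ^+ 2 * m)).
    move=> n0 m0; rewrite FE ?divr_gt0 //; field.
    by rewrite !gt_eqF //; positivity.
  rewrite Gx Gx1 !FG // => e.
  have cross : N1 * (N1 + a * b * M1) * x ^+ 2 * (M * (N + a ^+ 2 * M)) =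
     ph * N * (N + a * b * M) * (M1 * (N1 + a ^+ 2 * M1)).
    have : al * N1 * (N1 + a * b * M1) / (a * M1 * (N1 + a ^+ 2 * M1)) =
       ph * al * N * (N + a * b * M) / (x ^+ 2 * (a * M * (N + a ^+ 2 * M))).
      rewrite e; field.
      by rewrite !gt_eqF //; positivity.
    move/eqP; rewrite eqr_div; first last.
    - by rewrite gt_eqF //; positivity.
    - by rewrite gt_eqF //; positivity.
    move=> /eqP {}e; apply: (mulfI (x := al * a)).
      by rewrite gt_eqF //; positivity.
    transitivity (al * N1 * (N1 + a * b * M1)
                    * (x ^+ 2 * (a * M * (N + a ^+ 2 * M)))).
      by ring.
    by rewrite e; ring.
  apply: (mulfI (x := be * ph * x ^+ 2)).
    by rewrite gt_eqF //; positivity.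
  transitivity (ph * N * (N + a * b * M) * (M1 * (N1 + a ^+ 2 * M1))).
    by rewrite /N /M /N1 /M1 /quad; ring.
  by rewrite -cross /N /M /N1 /M1 /quad; ring.
move=> e6 e5 _.
have bE : b = a * c / d.
  apply: (mulfI (x := a * c * be * d)); first by rewrite gt_eqF //; positivity.
  have -> : a * c * be * d * (a * c / d) = c * be * (a ^+ 2 * c).
    by field; rewrite gt_eqF.
  by rewrite e6; ring.
have alE' : al = a * c / be by rewrite -alE mulfK // gt_eqF.
have : a ^+ 2 * c * (be * d ^+ 2 + a ^+ 2 * c) * (d - c) ^+ 2 = 0.
  move/eqP: e5; rewrite -subr_eq0 => /eqP e5.
  rewrite -[RHS](mulr0 (- (2 * d ^+ 2))) -e5 /ph alE' bE; field.
  by rewrite !gt_eqF.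
move/eqP; rewrite mulf_eq0 gt_eqF /=; last by positivity.
rewrite sqrf_eq0 subr_eq0 => /eqP dc; split=> //.
by rewrite bE dc mulfK // gt_eqF.
Qed.

(** The relation al be = e and the common constant ga come from the corner
    weights shared by F and G.  Take the equation at y = e, where F(e) = ph.  The
    coefficient of x^6 gives ga = e^2.  With m = be ph, the coefficient of x^5 is
    then a multiple of rh (m - 2 e^2), and for rh = 0 the coefficient of x^4 is a
    multiple of (m - 2 e^2)^2; finally m = 2 e^2 means q = 2 e. *)
Lemma closes_quadratic F G (al be e q ga rh : R) :
  0 < al -> 0 < be -> 0 < e -> 0 <= q -> 0 < ga -> 0 <= rh -> al * be = e ->
  (forall y, 0 < y -> F y = al * (y ^+ 2 + q * y + ga) / (y + e)) ->
  (forall x, 0 < x -> G x = be * (x ^+ 2 + rh * x) + ga) ->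
  hexagon_closes F G -> ga = e ^+ 2 /\ q = 2 * e.
Proof.
move=> al0 be0 e0 q0 ga0 rh0 alE FE GE h.
have quad0 t : 0 < t -> 0 < t ^+ 2 + q * t + ga.
  move=> t0; rewrite ltr_wpDl // addr_ge0 ?mulr_ge0 ?exprn_ge0 //; exact: ltW.
pose ph := al * (e ^+ 2 + q * e + ga) / (2 * e).
have ph0 : 0 < ph by rewrite divr_gt0 ?mulr_gt0 ?quad0.
have Fe : F e = ph by rewrite FE // /ph; congr (_ / _); ring.
(* The quartics come from w^2 + q e w + ga e^2 at w = G(x) and, multiplied by
   x^4, at w1 = G(ph / x); the quadratics are x^2 (w1 + e^2) and w + e^2. *)
have [] := @quartic_quadratic_top
  (ph * (ga ^+ 2 + q * e * ga + ga * e ^+ 2))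
  (ph * (2 * be * rh * ga + q * e * be * rh))
  (ph * (be ^+ 2 * rh ^+ 2 + 2 * be * ga + q * e * be))
  (ph * (2 * be ^+ 2 * rh)) (ph * be ^+ 2)
  (be * ph ^+ 2) (be * rh * ph) (ga + e ^+ 2)
  (be ^+ 2 * ph ^+ 4) (2 * be ^+ 2 * rh * ph ^+ 3)
  ((be * rh * ph) ^+ 2 + 2 * ga * be * ph ^+ 2 + q * e * be * ph ^+ 2)
  (2 * ga * be * rh * ph + q * e * be * rh * ph)
  (ga ^+ 2 + q * e * ga + ga * e ^+ 2)
  (ga + e ^+ 2) (be * rh) be.
  move=> x x0; have := h x e x0 e0; rewrite Fe.
  have p0 : 0 < ph / x by rewrite divr_gt0.
  have G0 t : 0 < t -> 0 < G t.
    move=> t0; rewrite GE // ltr_wpDl // mulr_ge0 ?(ltW be0) //.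
    by rewrite addr_ge0 ?mulr_ge0 ?exprn_ge0 // ltW.
  have FG t : 0 < t -> F (t / e) =
      al * (t ^+ 2 + q * e * t + ga * e ^+ 2) / (e * (t + e ^+ 2)).
    move=> t0; rewrite FE ?divr_gt0 //; field.
    by rewrite !gt_eqF //; positivity.
  rewrite !FG ?G0 //; set w := G x; set w1 := G (ph / x) => E.
  have [w0 w10] : 0 < w /\ 0 < w1 by split; apply: G0.
  have cross : (w1 ^+ 2 + q * e * w1 + ga * e ^+ 2) * (x ^+ 2 * (w + e ^+ 2)) =
     ph * (w ^+ 2 + q * e * w + ga * e ^+ 2) * (w1 + e ^+ 2).
    have : al * (w1 ^+ 2 + q * e * w1 + ga * e ^+ 2) / (e * (w1 + e ^+ 2)) =
       ph * al * (w ^+ 2 + q * e * w + ga * e ^+ 2)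
         / (x ^+ 2 * (e * (w + e ^+ 2))).
      rewrite E; field.
      by rewrite !gt_eqF //; positivity.
    move/eqP; rewrite eqr_div; first last.
    - by rewrite gt_eqF //; positivity.
    - by rewrite gt_eqF //; positivity.
    move=> /eqP {}E; apply: (mulfI (x := al * e)).
      by rewrite gt_eqF //; positivity.
    transitivity (al * (w1 ^+ 2 + q * e * w1 + ga * e ^+ 2)
                    * (x ^+ 2 * (e * (w + e ^+ 2)))); first by ring.
    by rewrite E; ring.
  have w1E : w1 * x ^+ 2 = be * (ph ^+ 2 + rh * ph * x) + ga * x ^+ 2.
    by rewrite /w1 GE //; field; rewrite gt_eqF.
  have wE : w = be * (x ^+ 2 + rh * x) + ga by rewrite /w GE.
  transitivity (ph * (w ^+ 2 + q * e * w + ga * e ^+ 2)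
                  * (w1 * x ^+ 2 + e ^+ 2 * x ^+ 2)).
    by rewrite w1E wE /quad; ring.
  transitivity (x ^+ 2 *
    (ph * (w ^+ 2 + q * e * w + ga * e ^+ 2) * (w1 + e ^+ 2))).
    by ring.
  rewrite -cross.
  transitivity (((w1 * x ^+ 2) ^+ 2 + q * e * (w1 * x ^+ 2) * x ^+ 2
     + ga * e ^+ 2 * x ^+ 4) * (w + e ^+ 2)); first by ring.
  by rewrite w1E wE /quad; ring.
move=> e6 e5 e4.
have sum0 := quad0 e e0.
have gaE : ga = e ^+ 2.
  have : be * (e ^+ 2 + q * e + ga) * (e ^+ 2 - ga) = 0.
    move/eqP: e6; rewrite -subr_eq0 => /eqP e6.
    rewrite -[RHS](mulr0 2) -e6 /ph -alE; field.
    by rewrite !gt_eqF.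
  move/eqP; rewrite mulf_eq0 gt_eqF /=; last by rewrite mulr_gt0.
  by rewrite subr_eq0 => /eqP ->.
split=> //; move: sum0 e5 e4; rewrite gaE => sum0 e5 e4.
pose m := e * (2 * e + q) / 2.
have m0 : 0 < m.
  by rewrite divr_gt0 // mulr_gt0 // ltr_wpDr // mulr_gt0.
have phE : ph = m / be.
  by rewrite /ph /m gaE -alE; field; rewrite !gt_eqF //; positivity.
suff : (m - 2 * e ^+ 2) ^+ 2 = 0.
  move/eqP; rewrite sqrf_eq0 => /eqP h2; apply: (mulfI (x := e)).
    by rewrite gt_eqF.
  have : m = e ^+ 2 + e * q / 2 by rewrite /m; field.
  by move: h2; nra.
have [rh_eq0|rh_neq0] := eqVneq rh 0.
  move/eqP: e4; rewrite -subr_eq0 rh_eq0 phE => /eqP e4.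
  apply: (mulfI (x := - m)); first by rewrite oppr_eq0 gt_eqF.
  rewrite mulr0 -e4 /m; field.
  by rewrite !gt_eqF.
move/eqP: e5; rewrite -subr_eq0 phE => /eqP e5.
suff -> : m - 2 * e ^+ 2 = 0 by rewrite expr0n.
apply: (mulfI (x := - (be * rh * m))).
  by rewrite oppr_eq0 mulf_neq0 ?(gt_eqF m0) // mulf_neq0 // gt_eqF.
rewrite mulr0 -e5 /m; field.
by rewrite !gt_eqF.
Qed.

End LeadingTerms.

(** * Orders of growth and zero patterns *)

Section Growth.
Variable R : realType.
Implicit Types (P Q : 'M[R]_3) (u v : R -> R) (k l : int).

(** Two-sided bounds are enough to determine k, and unlike limits they need no
    control of constants under composition. *)
Definition growth u k : Prop := exists C, 0 < C /\
  forall x, 1 <= x -> u x <= C * x ^ k /\ x ^ k <= C * u x.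

Lemma growth_ext u v k : (forall x, 1 <= x -> u x = v x) ->
  growth u k -> growth v k.
Proof.
by move=> uv [C [C0 h]]; exists C; split=> // x x1; rewrite -uv //; exact: h.
Qed.

Let expz_gt0 (x : R) k : 1 <= x -> 0 < x ^ k.
Proof. by move=> x1; rewrite exprz_gt0 // (lt_le_trans ltr01). Qed.

Lemma growth_gt0 u k x : growth u k -> 1 <= x -> 0 < u x.
Proof.
move=> [C [C0 h]] x1; have [_ ux] := h x x1.
by rewrite -(pmulr_rgt0 _ C0) (lt_le_trans _ ux) // expz_gt0.
Qed.

Lemma growth_inj u k l : growth u k -> growth u l -> k = l.
Proof.
wlog: k l / l <= k.
  by move=> h uk ul; case: (leP l k) => [|/ltW] kl; [|symmetry]; apply: h.
move=> lk [C [C0 h]] [D [D0 h']]; apply/eqP; rewrite eq_le lk andbT leNgt.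
apply/negP => lt; pose x := C * D + 1.
have x1 : 1 <= x by rewrite lerDr ltW // mulr_gt0.
have [_ uk] := h x x1; have [ul _] := h' x x1.
have : x ^ k <= C * D * x ^ l.
  by rewrite (le_trans uk) // -mulrA ler_pM2l.
have -> : x ^ k = x ^ (k - l) * x ^ l.
  by rewrite -expfzDr ?subrK // gt_eqF // (lt_le_trans ltr01).
rewrite ler_pM2r ?expz_gt0 // => le.
have : x <= x ^ (k - l) by rewrite -{1}[x]expr1z ler_weXz2l //; lia.
by move/le_trans => /(_ _ le); rewrite /x gerDl leNgt ltr01.
Qed.

Lemma growthM u v k l : growth u k -> growth v l ->
  growth (fun x => u x * v x) (k + l).
Proof.
move=> uk vl; have [C [C0 h]] := uk; have [D [D0 h']] := vl.
exists (C * D); split=> [|x x1]; first exact: mulr_gt0.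
have [u1 u2] := h x x1; have [v1 v2] := h' x x1.
have [u0 v0] := (growth_gt0 uk x1, growth_gt0 vl x1).
rewrite expfzDr ?gt_eqF ?(lt_le_trans ltr01) // !(mulrACA C D).
by split; apply: ler_pM; rewrite // ltW // expz_gt0.
Qed.

Lemma growthV u k : growth u k -> growth (fun x => (u x)^-1) (- k).
Proof.
move=> uk; have [C [C0 h]] := uk; exists C; split=> // x x1.
have [u1 u2] := h x x1; have u0 := growth_gt0 uk x1.
have xk := expz_gt0 k x1; rewrite -invr_expz.
split.
  by rewrite -ler_pdivrMl // -invfM lef_pV2 ?posrE ?mulr_gt0 // mulrC.
by rewrite -ler_pdivrMl // -invfM lef_pV2 ?posrE ?mulr_gt0 // mulrC.
Qed.

Lemma growth_cst (c : R) : 0 < c -> growth (fun=> c) 0.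
Proof.
move=> c0; exists (c + c^-1); split; first by rewrite addr_gt0 ?invr_gt0.
move=> x _; rewrite expr0z mulr1 mulrDl mulVf ?gt_eqF //.
by rewrite lerDl invr_ge0 ltW // lerDr mulr_ge0 // ltW.
Qed.

Lemma growth_id : growth id 1.
Proof. by exists 1; split=> // x x1; rewrite expr1z mul1r. Qed.

Lemma growthZ (c : R) u k : 0 < c -> growth u k -> growth (fun x => c * u x) k.
Proof.
by move=> c0 uk; rewrite -[k]add0r; apply: growthM (growth_cst c0) uk.
Qed.

(** Nonnegativity of c v excludes cancellation. *)
Lemma growth_absorb (c : R) u v k l : 0 <= c -> l <= k ->
  growth u k -> growth v l -> growth (fun x => u x + c * v x) k.
Proof.
move=> c0 lk uk vl; have [C [C0 h]] := uk; have [D [D0 h']] := vl.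
have CD : 0 <= c * D by rewrite mulr_ge0 // ltW.
exists (C + c * D); split; first by rewrite ltr_wpDr.
move=> x x1; have [u1 u2] := h x x1; have [v1 v2] := h' x x1.
have [u0 v0] := (growth_gt0 uk x1, growth_gt0 vl x1).
split.
  rewrite mulrDl lerD // -mulrA ler_wpM2l // (le_trans v1) // ler_pM2l //.
  exact: ler_weXz2l.
apply: (le_trans u2); apply: ler_pM; rewrite ?lerDl ?(ltW C0) ?(ltW u0) //.
by rewrite mulr_ge0 // ltW.
Qed.

(** The tropical quadratic: the largest of the exponents 2k, k, 0 over the
    monomials of a t^2 + b t + c that are present (at least one is). *)
Definition trop (a b c : bool) k : int :=
  if 0 <= k then (if a then k + k else if b then k else 0)
  else (if c then 0 else if b then k else k + k).

Lemma growth_quad (a b c : R) u k : 0 <= a -> 0 <= b -> 0 <= c ->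
  [|| a != 0, b != 0 | c != 0] -> growth u k ->
  growth (fun x => quad a b c (u x)) (trop (a != 0) (b != 0) (c != 0) k).
Proof.
move=> a0 b0 c0 abc uk.
have g1 := growth_cst (@ltr01 R); have g2 := growthM uk uk.
have pos (t : R) : 0 <= t -> t != 0 -> 0 < t.
  by move=> t0 tn; rewrite lt_neqAle eq_sym tn.
rewrite /trop /quad; case: leP => k0.
  have [az|an] := eqVneq a 0; last first.
    have l1 : 0 <= k + k by rewrite addr_ge0.
    have l2 : k <= k + k by rewrite lerDl.
    have := growth_absorb c0 l1
      (growth_absorb b0 l2 (growthZ (pos _ a0 an) g2) uk) g1.
    by apply: growth_ext => x _; ring.
  have [bz|bn] := eqVneq b 0; last first.
    have := growth_absorb c0 k0 (growthZ (pos _ b0 bn) uk) g1.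
    by apply: growth_ext => x _; rewrite az; ring.
  move: abc; rewrite az bz eqxx /= => cn.
  by apply: growth_ext (growth_cst (pos _ c0 cn)) => x _; ring.
have [cz|cn] := eqVneq c 0; last first.
  have l1 : k + k <= 0 by lia.
  have := growth_absorb a0 l1
    (growth_absorb b0 (ltW k0) (growth_cst (pos _ c0 cn)) uk) g2.
  by apply: growth_ext => x _; ring.
have [bz|bn] := eqVneq b 0; last first.
  have l1 : k + k <= k by lia.
  have := growth_absorb a0 l1 (growthZ (pos _ b0 bn) uk) g2.
  by apply: growth_ext => x _; rewrite cz; ring.
move: abc; rewrite cz bz eqxx /= orbF => an.
by apply: growth_ext (growthZ (pos _ a0 an) g2) => x _; ring.
Qed.

Definition entry (t : seq (seq bool)) i j : bool := nth false (nth [::] t i) j.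

Definition xtrop t k : int :=
  trop (entry t 2 0) (entry t 2 1) (entry t 2 2) k
  - trop (entry t 0 0) (entry t 0 1) (entry t 0 2) k.

Definition transp (t : seq (seq bool)) :=
  [seq [seq entry t i j | i <- iota 0 3] | j <- iota 0 3].

Definition step_table P : seq (seq bool) :=
  [:: [:: P 0 0 != 0; P 0 1 != 0; P 0 2 != 0];
      [:: P 1 0 != 0; P 1 1 != 0; P 1 2 != 0];
      [:: P 2 0 != 0; P 2 1 != 0; P 2 2 != 0]].

Lemma growth_xprod P u k : walk_matrix P -> growth u k ->
  growth (fun x => xprod P (u x)) (xtrop (step_table P) k).
Proof.
case=> p0 p1 p2 _ _ uk; apply: growthM; last apply: growthV.
  exact: growth_quad.
exact: growth_quad.
Qed.

Lemma step_table_tr P : step_table P^T = transp (step_table P).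
Proof. by rewrite /step_table !mxE. Qed.

(** The exponents of x on the two sides of the hexagon equation at y = 1. *)
Definition trop_closes t : bool :=
  xtrop t (xtrop (transp t) (-1)) == xtrop t (xtrop (transp t) 1) - 2.

Lemma closes_trop P : walk_matrix P -> hexagon_closes (xprod P) (yprod P) ->
  trop_closes (step_table P).
Proof.
move=> Pw h; have X0 : 0 < xprod P 1 by exact: xprod_gt0.
have gV : growth (fun x => xprod P 1 / x) (-1).
  by have := growthM (growth_cst X0) (growthV growth_id).
have Yw := walk_matrix_tr Pw.
have lhs := growth_xprod Pw (growth_xprod Yw gV).
have rhs := growthM gV
  (growthM (growth_xprod Pw (growth_xprod Yw growth_id)) (growthV growth_id)).
have := growth_inj (growth_ext _ lhs) rhs.
rewrite /trop_closes -!step_table_tr => -> //; first by apply/eqP; ring.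
move=> x x1; have := h x 1 (lt_le_trans ltr01 x1) ltr01.
by rewrite !divr1.
Qed.

(** These eight matrices exhaust the orbit of P: transpositions can be moved past
    the reversals. *)
Definition square_sym (tr r c : bool) P : 'M[R]_3 :=
  let Q := if tr then P^T else P in
  let Q' := if r then rowsub (@rev_ord 3) Q else Q in
  if c then colsub (@rev_ord 3) Q' else Q'.

Definition table_sym (tr r c : bool) t : seq (seq bool) :=
  let t1 := if tr then transp t else t in
  let t2 := if r then rev t1 else t1 in
  if c then map rev t2 else t2.

Lemma step_table_rows P :
  step_table (rowsub (@rev_ord 3) P) = rev (step_table P).
Proof. by have [h0 h1 h2] := rev_ord3; rewrite /step_table !mxE h0 h1 h2. Qed.

Lemma step_table_cols P :
  step_table (colsub (@rev_ord 3) P) = map rev (step_table P).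
Proof. by have [h0 h1 h2] := rev_ord3; rewrite /step_table !mxE h0 h1 h2. Qed.

Lemma step_table_sym tr r c P :
  step_table (square_sym tr r c P) = table_sym tr r c (step_table P).
Proof.
by case: tr; case: r; case: c;
  rewrite /square_sym ?(step_table_rows, step_table_cols, step_table_tr).
Qed.

Lemma square_sym_orbit tr r c P : square_orbit P (square_sym tr r c P).
Proof.
have o1 : square_orbit P (if tr then P^T else P) by case: tr; do 2?constructor.
rewrite /square_sym; move: o1; set Q := if tr then _ else _ => o1.
have o2 : square_orbit P (if r then rowsub (@rev_ord 3) Q else Q).
  by case: r; [constructor|].
by case: c; [constructor|].
Qed.

Definition shape_I t := [&& ~~ entry t 0 0, entry t 0 1, ~~ entry t 0 2,
  ~~ entry t 1 0, entry t 1 2, entry t 2 0, ~~ entry t 2 1 & ~~ entry t 2 2].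

Definition shape_II t := [&& ~~ entry t 0 0, entry t 0 1, entry t 0 2,
  ~~ entry t 1 0, entry t 2 0 & entry t 2 2].

Definition shape_III t := [&& ~~ entry t 0 0, entry t 0 1, entry t 0 2,
  entry t 1 0, entry t 1 2, entry t 2 0, entry t 2 1 & ~~ entry t 2 2].

Definition shapely t := [|| shape_I t, shape_II t | shape_III t].

Definition sides t := [&& [|| entry t 0 0, entry t 0 1 | entry t 0 2],
  [|| entry t 2 0, entry t 2 1 | entry t 2 2],
  [|| entry t 0 0, entry t 1 0 | entry t 2 0] &
  [|| entry t 0 2, entry t 1 2 | entry t 2 2]].

Let has_bool (p : bool -> bool) := p true || p false.
Let has_boolP p : has_bool p -> exists b, p b.
Proof. by case/orP; [exists true|exists false]. Qed.

(** The tropical equations have only finitely many instances, and all are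
    decided by computation. *)
Lemma trop_shapely a b c d e f g h i :
  let t := [:: [:: a; b; c]; [:: d; e; f]; [:: g; h; i]] in
  sides t -> trop_closes t -> trop_closes (transp t) ->
  exists tr, exists r, exists s, shapely (table_sym tr r s t).
Proof.
move=> t s1 s2 s3.
suff : has_bool (fun tr => has_bool (fun r => has_bool (fun s =>
    shapely (table_sym tr r s t)))).
  case/has_boolP=> tr /has_boolP[r /has_boolP[s ts]].
  by exists tr, r, s.
move: s1 s2 s3; rewrite {}/t.
by case: a; case: b; case: c; case: d; case: e; case: f; case: g; case: h;
  case: i; vm_compute.
Qed.

End Growth.

(** * The classification *)

Section Classification.
Variable R : realType.
Implicit Types (P Q : 'M[R]_3).

Lemma mx3_entries P : P = mx3 [:: [:: P 0 0; P 0 1; P 0 2];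
  [:: P 1 0; P 1 1; P 1 2]; [:: P 2 0; P 2 1; P 2 2]].
Proof.
apply/matrixP => i j; rewrite mxE.
have ord3 (k : 'I_3) : [\/ k = 0, k = 1 | k = 2].
  case: k => [[|[|[|k]]]] // h;
    [constructor 1|constructor 2|constructor 3]; exact: val_inj.
by case: (ord3 i) => ->; case: (ord3 j) => ->.
Qed.

Lemma shape_I_family P : shape_I (step_table P) -> family_I P.
Proof.
rewrite /shape_I /entry /= !negbK.
case/and5P=> /eqP z1 n1 /eqP z2 /eqP z3 /and4P[n2 n3 /eqP z4 /eqP z5].
exists (P 0 1), (P 1 1), (P 1 2), (P 2 0); split; last by rewrite !mulf_neq0.
by rewrite {1}[P]mx3_entries z1 z2 z3 z4 z5.
Qed.

Lemma shape_II_family P : walk_matrix P ->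
  hexagon_closes (xprod P) (yprod P) -> shape_II (step_table P) -> family_II P.
Proof.
move=> [p0 _ _ _ _] h.
rewrite /shape_II /entry /= !negbK.
case/and5P=> /eqP z1 n1 n2 /eqP z2 /andP[n3 n4].
have pos i j : P i j != 0 -> 0 < P i j.
  by move=> n; rewrite lt_neqAle eq_sym n p0.
have [h1 h2 h3 h4] : [/\ 0 < P 0 1, 0 < P 0 2, 0 < P 2 0 & 0 < P 2 2].
  by split; exact: pos.
have XE y : 0 < y -> xprod P y = P 2 0 / P 0 1 *
    (y ^+ 2 + P 2 1 / P 2 0 * y + P 2 2 / P 2 0) / (y + P 0 2 / P 0 1).
  move=> y0; rewrite /xprod z1 /quad; field.
  by rewrite !gt_eqF //; positivity.
have YE x : 0 < x -> yprod P x = P 0 2 / P 2 0 *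
    (x ^+ 2 + P 1 2 / P 0 2 * x) + P 2 2 / P 2 0.
  move=> x0; rewrite /yprod /xprod !mxE z1 z2 /quad; field.
  by rewrite n2 n3.
have [] := closes_quadratic _ _ _ _ _ _ _ XE YE h.
1,2,3,5: exact: divr_gt0.
1,2: exact: divr_ge0.
  by field; rewrite n1 n3.
move=> e22 e21.
exists (P 0 1), (P 0 2), (P 1 1), (P 1 2), (P 2 0).
split; last by rewrite !mulf_neq0.
have -> : 2 * P 0 2 * P 2 0 / P 0 1 = P 2 1.
  by rewrite -[RHS](divfK n3) e21; field.
have -> : P 0 2 ^+ 2 * P 2 0 / P 0 1 ^+ 2 = P 2 2.
  by rewrite -[RHS](divfK n3) e22; field.
by rewrite {1}[P]mx3_entries z1 z2.
Qed.

Lemma shape_III_family P : walk_matrix P ->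
  hexagon_closes (xprod P) (yprod P) -> shape_III (step_table P) ->
  family_III P.
Proof.
move=> [p0 _ _ _ _] h.
rewrite /shape_III /entry /= !negbK.
case/and5P=> /eqP z1 n1 n2 n3 /and4P[n4 n5 n6 /eqP z2].
have pos i j : P i j != 0 -> 0 < P i j.
  by move=> n; rewrite lt_neqAle eq_sym n p0.
have [h1 h2 h3] : [/\ 0 < P 0 1, 0 < P 0 2 & 0 < P 1 0] by split; exact: pos.
have [h4 h5 h6] : [/\ 0 < P 1 2, 0 < P 2 0 & 0 < P 2 1] by split; exact: pos.
have XE y : 0 < y -> xprod P y =
    P 2 0 / P 0 1 * y * (y + P 2 1 / P 2 0) / (y + P 0 2 / P 0 1).
  move=> y0; rewrite /xprod z1 z2 /quad; field.
  by rewrite n1 n5 !gt_eqF //; positivity.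
have YE x : 0 < x -> yprod P x =
    P 0 2 / P 1 0 * x * (x + P 1 2 / P 0 2) / (x + P 2 0 / P 1 0).
  move=> x0; rewrite /yprod /xprod !mxE z1 z2 /quad; field.
  by rewrite n2 n3 !gt_eqF //; positivity.
have [] := closes_homographic _ _ _ _ _ _ _ XE YE h; try exact: divr_gt0.
  by field; rewrite n1 n3.
move=> e1 e2.
exists (P 0 2), (P 1 1), (P 1 2), (P 2 0), (P 2 1).
split; last by rewrite !mulf_neq0.
have -> : P 0 2 * P 2 0 / P 2 1 = P 0 1.
  apply: (mulIf n6); rewrite divfK // -[P 2 1](divfK n5) e1.
  by field.
have -> : P 0 2 * P 2 0 / P 1 2 = P 1 0.
  apply: (mulIf n4); rewrite divfK // -[P 1 2](divfK n2) e2.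
  by field.
by rewrite {1}[P]mx3_entries z1 z2.
Qed.

Lemma hexagonal_families P : walk_matrix P -> hexagonal P ->
  exists2 Q, square_orbit P Q & [\/ family_I Q, family_II Q | family_III Q].
Proof.
move=> Pw Ph; have [_ p1 p2 p3 p4] := Pw.
have s : sides (step_table P) by apply/and4P.
have Ph' := hexagonal_tr Ph; have Pw' := walk_matrix_tr Pw.
have tt : trop_closes (transp (step_table P)).
  by rewrite -step_table_tr; apply: closes_trop => //; case: Ph'.
have [tr [r [c]]] := trop_shapely s (closes_trop Pw (proj1 Ph)) tt.
rewrite -step_table_sym => sh; exists (square_sym tr r c P).
  exact: square_sym_orbit.
have [Qw QP] := square_orbit_hexagonal (square_sym_orbit tr r c P) Pw.
have [h _] := proj2 QP Ph; case/or3P: sh => sh.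
- by constructor 1; exact: shape_I_family.
- by constructor 2; exact: shape_II_family.
- by constructor 3; exact: shape_III_family.
Qed.

Lemma walk_matrix_intro P : (forall i j, 0 <= P i j) ->
  A1 P != 0 -> C1 P != 0 -> A2 P != 0 -> C2 P != 0 -> walk_matrix P.
Proof.
move=> p0 a1 c1 a2 c2.
have nz (t : ratfun R) (u : 'I_3 -> R) :
    \sum_(k < 3) ratC (u k) * t ^ step k != 0 ->
    [|| u 0 != 0, u 1 != 0 | u 2 != 0].
  apply: contraNT; rewrite !negb_or !negbK => /and3P[/eqP u0 /eqP u1 /eqP u2].
  rewrite sum_step u0 u1 u2 /ratC mpolyC0 /ratpoly tofrac0.
  by rewrite mulr0 mul0r !addr0.
by split=> //; [exact: nz a1|exact: nz c1|exact: nz a2|exact: nz c2].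
Qed.

End Classification.

Theorem theorem4p1 (R : realType) (P : 'M[R]_3)
  (P_ge0 : forall r c : 'I_3, 0 <= P r c)
  (P_sum1 : \sum_(r < 3) \sum_(c < 3) P r c = 1)
  (A1_neq0 : A1 P != 0) (C1_neq0 : C1 P != 0)
  (A2_neq0 : A2 P != 0) (C2_neq0 : C2 P != 0) :
  (walk_group P #= `I_6)%card <->
  exists2 Q : 'M[R]_3, square_orbit P Q &
    [\/ family_I Q, family_II Q | family_III Q].
Proof.
have Pw := walk_matrix_intro P_ge0 A1_neq0 C1_neq0 A2_neq0 C2_neq0.
rewrite (order6_hexagonal Pw); split; first exact: hexagonal_families.
case=> Q PQ QF; have [Qw QP] := square_orbit_hexagonal PQ Pw.
exact: (proj1 QP (families_hexagonal Qw QF)).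
Qed.
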